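(* Let $\mathfrak{spin}(9)\subset\mathfrak{so}(16)$ be given by the unique irreducible $16$-dimensional representation of the Lie algebra $\mathfrak{spin}(9)$. Its antisymmetric prolongation vanishes: $$\mathrm{T}(\mathfrak{spin}(9),\mathbb{R}^{16})=0 .$$
   Context: For a compact semisimple Lie algebra $\mathfrak{g}\subset\mathfrak{so}(n)$ acting on euclidean space $\mathbb{R}^n$, the antisymmetric prolongation of the representation is $$\mathrm{T}(\mathfrak{g},\mathbb{R}^n):=\{\mathrm{T}\in\Lambda^3(\mathbb{R}^n): X\lrcorner\,\mathrm{T}\in\mathfrak{g}\ \text{for any }X\in\mathbb{R}^n\},$$ where $X\lrcorner\,\mathrm{T}$ is the interior product and $2$-forms are identified with elements of $\mathfrak{so}(n)$. The $16$-dimensional representation of $\mathfrak{spin}(9)$ is its real spin representation. *)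

(* Defs.v *)
From HB Require Import structures.
From mathcomp Require Import all_boot all_order all_algebra.
From mathcomp Require Import boolp classical_sets reals.

Set Implicit Arguments.
Unset Strict Implicit.
Unset Printing Implicit Defensive.

Import Order.TTheory GRing.Theory Num.Theory.
Local Open Scope ring_scope.
Local Open Scope classical_set_scope.

Definition lie_bracket (R : realType) (n : nat) (A B : 'M[R]_n) : 'M[R]_n :=
  A *m B - B *m A.

Definition so (R : realType) (n : nat) : {vspace 'M[R]_n} :=
  lker (linfun (@trmx R n n) + \1)%VF.

Lemma mem_so (R : realType) (n : nat) (A : 'M[R]_n) :
  (A \in so R n) = (A^T == - A).
Proof. by rewrite memv_ker add_lfunE id_lfunE lfunE addr_eq0. Qed.

Lemma lie_bracket_so (R : realType) (n : nat) (A B : 'M[R]_n) :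
  A \in so R n -> B \in so R n -> lie_bracket A B \in so R n.
Proof.
rewrite !mem_so => /eqP hA /eqP hB.
rewrite /lie_bracket linearB /= !trmx_mul hA hB.
by rewrite !mulNmx !mulmxN !opprK opprB.
Qed.

(* The differential of the double covering Spin(n) -> SO(n) is an isomorphism
   of Lie algebras; the Lie algebra spin(n) is identified with so(n) along it.
   This is the Lie algebra alone: its spin representation is a representation
   different from the inclusion of so(n) in the n x n matrices. *)
Definition spin (R : realType) (n : nat) : {vspace 'M[R]_n} := so R n.

Definition spin_bracket (R : realType) (n : nat)
    (x y : subvs_of (spin R n)) : subvs_of (spin R n) :=
  vsproj (spin R n) (lie_bracket (vsval x) (vsval y)).

(* vsproj is a projection of the whole matrix space; spin_bracket is the matrix
   commutator because the latter already lies in spin(n). *)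
Lemma val_spin_bracket (R : realType) (n : nat) (x y : subvs_of (spin R n)) :
  vsval (spin_bracket x y) = lie_bracket (vsval x) (vsval y).
Proof. by rewrite vsprojK // lie_bracket_so ?subvsP. Qed.

Definition lie_representation (R : realType) (n m : nat)
    (rho : 'Hom(subvs_of (spin R n), 'M[R]_m)) : Prop :=
  forall x y, rho (spin_bracket x y) = lie_bracket (rho x) (rho y).

Definition irreducible (R : realType) (n : nat) (g : {vspace 'M[R]_n}) : Prop :=
  (0 < n)%N /\
  forall U : {vspace 'cV[R]_n},
    (forall A v, A \in g -> v \in U -> A *m v \in U) ->
    U = 0%VS \/ U = fullv.

Definition form2 (R : realType) (n : nat) : Type :=
  'cV[R]_n -> 'cV[R]_n -> R.
Definition form3 (R : realType) (n : nat) : Type :=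
  'cV[R]_n -> 'cV[R]_n -> 'cV[R]_n -> R.

(* Lambda^3(R^n), as the alternating trilinear forms *)
Definition Lambda3 (R : realType) (n : nat) : set (form3 R n) :=
  [set T | [/\ forall Y Z, scalar (fun X => T X Y Z),
               forall X Z, scalar (fun Y => T X Y Z),
               forall X Y, scalar (fun Z => T X Y Z),
               forall X Y, T X X Y = 0 &
               forall X Y, T X Y Y = 0]].

Definition interior (R : realType) (n : nat) (X : 'cV[R]_n) (T : form3 R n) :
    form2 R n :=
  fun Y Z => T X Y Z.

(* The 2-form w corresponds to the skew matrix A with w(Y, Z) = Y^T A Z. The
   other usual convention, w(Y, Z) = <A Y, Z>, changes A to -A, and hence does
   not affect membership in a linear subspace of so(n). *)
Definition form2_mx (R : realType) (n : nat) (w : form2 R n) : 'M[R]_n :=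
  \matrix_(i, j) w (delta_mx i 0) (delta_mx j 0).

Definition antisym_prolongation (R : realType) (n : nat)
    (g : {vspace 'M[R]_n}) : set (form3 R n) :=
  [set T | Lambda3 T /\ forall X : 'cV[R]_n, form2_mx (interior X T) \in g].

(* Main.v *)
Require Import Defs.
From HB Require Import structures.
From mathcomp Require Import all_boot all_order all_algebra.
From mathcomp Require Import boolp classical_sets reals.
From mathcomp Require Import complex ring zify.

Set Implicit Arguments.
Unset Strict Implicit.
Unset Printing Implicit Defensive.

Import Order.TTheory GRing.Theory Num.Theory.
Local Open Scope ring_scope.
Local Open Scope classical_set_scope.

(** Write A_xy for the image under rho of the rotation generator in the plane
of the coordinates x and y, and extend scalars to the complex numbers.  The
matrices of a Cartan subalgebra have a common eigenvector, and strings of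
weights along the short roots e_k and the long roots e_k - e_l
([short_string], [long_string]) show that doubled weights are integral
vectors whose coordinates have the same parity, and produce new weights from
given ones.  As the space has dimension 16, only two cases remain
([weights_dichotomy]).

If the doubled weights are even, then 0 is a weight and no weight has two
nonzero coordinates, because such a weight would generate more than 16 weights.
A vector of weight 0 is then fixed by so(8), and together with its images under
the other eight generators it spans a proper invariant subspace
([no_zero_weight_vector]), which contradicts irreducibility.

If they are odd, then the 16 sign vectors are the doubled weights, each of
multiplicity one, as for the spin representation.  In a basis u_d of weight
vectors, indexed by the sign vectors d, every A_xy sends u_d to a multiple of
the vector whose sign vector differs from d in the Cartan planes that contain
exactly one of x and y.  Hence an element G of the image, read as a bilinear
form, has the following properties:
- G(u_d, u_e) = 0 if d and e agree in at least three places
  ([dot_agreement_gt2]);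
- if d and e agree in exactly two places, then flipping both at a place where
  they differ does not change whether G(u_d, u_e) vanishes ([dot_flip]);
- G(u_d, u_e) for opposite d and e is, up to a nonzero factor, a linear
  function of the signs of d ([dot_opp_span]).
An alternating form T with all its contractions in the image therefore
vanishes on any three basis vectors u_a, u_b, u_c ([alternating_vanish]).
Among three sign vectors of length four, two agree in at least two places, say
b and c.  If they agree in more, then T is 0.  If they agree in exactly two,
flips make b agree with a, and c opposite to a, at the two other places; then
b agrees with a in three places, or c is opposite to a.  Finally T vanishes on
a, d, -d for all d: it does so when d is a or differs from a in one place, and
these values determine a linear function of the signs. *)

(** * Matrices: eigenvalues, commutators and sl2-strings *)

Lemma size_eigenvalues (F : fieldType) n (g : 'M[F]_n) (s : seq F) :
  uniq s ->
  (forall a, a \in s -> exists2 v : 'cV_n, v != 0 & g *m v = a *: v) ->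
  (size s <= n)%N.
Proof.
move=> us hs; rewrite -ltnS -(size_char_poly g^T).
apply: max_poly_roots => //; first by rewrite monic_neq0 ?char_poly_monic.
apply/allP => a /hs [v v0 gv]; rewrite -eigenvalue_root_char.
apply/eigenvalueP; exists v^T; first by rewrite -trmx_mul gv linearZ.
by rewrite -(inj_eq trmx_inj) trmxK trmx0.
Qed.

Definition mxlie (F : nzRingType) n (X Y : 'M[F]_n) : 'M[F]_n :=
  X *m Y - Y *m X.

Section MxLie.
Variables (F : comNzRingType) (n : nat).
Implicit Types X Y Z : 'M[F]_n.

Lemma mxlieC X Y : mxlie X Y = - mxlie Y X.
Proof. by rewrite /mxlie opprB. Qed.

Lemma mxlieDr X Y Z : mxlie X (Y + Z) = mxlie X Y + mxlie X Z.
Proof. by rewrite /mxlie mulmxDl mulmxDr opprD addrACA. Qed.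

Lemma mxlieDl X Y Z : mxlie (Y + Z) X = mxlie Y X + mxlie Z X.
Proof. by rewrite /mxlie mulmxDl mulmxDr opprD addrACA. Qed.

Lemma mxlieZr a X Y : mxlie X (a *: Y) = a *: mxlie X Y.
Proof. by rewrite /mxlie -scalemxAl -scalemxAr scalerBr. Qed.

Lemma mxlieZl a X Y : mxlie (a *: X) Y = a *: mxlie X Y.
Proof. by rewrite /mxlie -scalemxAl -scalemxAr scalerBr. Qed.

Lemma mxlieNr X Y : mxlie X (- Y) = - mxlie X Y.
Proof. by rewrite -!scaleN1r mxlieZr. Qed.

Lemma mxlieNl X Y : mxlie (- X) Y = - mxlie X Y.
Proof. by rewrite mxlieC mxlieNr opprK mxlieC. Qed.

Lemma mxlie_apply m X Y (v : 'M[F]_(n, m)) :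
  X *m (Y *m v) = mxlie X Y *m v + Y *m (X *m v).
Proof. by rewrite /mxlie mulmxBl !mulmxA subrK. Qed.

End MxLie.

Section Sl2.
Variables (F : numFieldType) (n : nat).
Implicit Types (h e f : 'M[F]_n) (v w : 'cV[F]_n) (c k : F).

Lemma shift_iter h e v (a c : F) p :
  mxlie h e = a *: e -> h *m v = c *: v ->
  h *m iter p (mulmx e) v = (c + a * p%:R) *: iter p (mulmx e) v.
Proof.
move=> he hv; elim: p => [|p IH] /=; first by rewrite mulr0 addr0.
rewrite mxlie_apply he -scalemxAl IH -scalemxAr -scalerDl; congr (_ *: _).
by rewrite -natr1; ring.
Qed.

(** The nonzero vectors among the images of v under powers of e have distinct
eigenvalues for h. *)
Lemma shift_nilp h e v (a c : F) :
  a != 0 -> mxlie h e = a *: e -> h *m v = c *: v -> v != 0 ->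
  exists2 p, iter p (mulmx e) v != 0 & iter p.+1 (mulmx e) v = 0.
Proof.
move=> a0 he hv v0.
have [k hk] : exists k : nat, iter k (mulmx e) v == 0.
  apply: contrapT => hk.
  suff : (n.+1 <= n)%N by rewrite ltnn.
  rewrite -{1}(size_iota 0 n.+1) -(size_map (fun p => c + a * p%:R)).
  apply: (@size_eigenvalues _ _ h); last first.
    move=> b /mapP [p _ ->]; exists (iter p (mulmx e) v).
      by apply/negP => /eqP hp; apply: hk; exists p; apply/eqP.
    exact: shift_iter.
  rewrite map_inj_uniq ?iota_uniq // => p q /addrI /(mulfI a0) /eqP.
  by rewrite eqr_nat => /eqP.
have ex : exists k : nat, iter k (mulmx e) v == 0 by exists k.
case: (ex_minnP ex) => -[|p] hp hmin; first by move: v0; rewrite hp.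
exists p; last exact/eqP.
by apply/negP => /hmin; rewrite ltnn.
Qed.

(** The string descends from a highest weight vector w = e^p v, of eigenvalue
d = c + p.  By induction e f^(q+1) w is a multiple of f^q w with a factor
proportional to (q + 1)(2d - q); if f^(N+1) is the first power of f that kills
w, the factor for q = N vanishes, so that 2d = N. *)
Lemma sl2_string h e f v c k :
  mxlie h e = e -> mxlie h f = - f -> mxlie e f = k *: h -> k != 0 ->
  h *m v = c *: v -> v != 0 ->
  exists p N, 2%:R * (c + p%:R) = N%:R /\
    forall q, (q <= N)%N -> iter q (mulmx f) (iter p (mulmx e) v) != 0.
Proof.
move=> he hf ef k0 hv v0.
have he1 : mxlie h e = 1 *: e by rewrite scale1r.
have hf1 : mxlie h f = (-1) *: f by rewrite scaleN1r.
have [|p w0 ew] := shift_nilp _ he1 hv v0; first exact: oner_neq0.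
have hw := shift_iter p he1 hv; rewrite mul1r in hw.
rewrite iterS in ew.
exists p; move: (iter p (mulmx e) v) (c + p%:R) w0 hw ew => w d w0 hw ew.
have [|N fN fN1] := shift_nilp _ hf1 hw w0; first by rewrite oppr_eq0 oner_neq0.
have efw q : 2%:R *: (e *m iter q.+1 (mulmx f) w)
    = (k * (q.+1%:R * (2%:R * d - q%:R))) *: iter q (mulmx f) w.
  elim: q => [|q IH].
    rewrite /= mxlie_apply ef -scalemxAl hw ew mulmx0 addr0 !scalerA.
    by congr (_ *: _); ring.
  rewrite [iter q.+2 _ _]iterS mxlie_apply ef -scalemxAl (shift_iter _ hf1 hw).
  rewrite scalerDr (scalemxAr 2%:R f) IH -scalemxAr !scalerA -scalerDl.
  by congr (_ *: _); rewrite -!natr1; ring.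
exists N; split.
  have := efw N; rewrite fN1 mulmx0 scaler0 => /esym/eqP.
  rewrite scaler_eq0 (negPf fN) orbF !mulf_eq0 (negPf k0) pnatr_eq0 /= subr_eq0.
  by move/eqP.
have z r : iter r (mulmx f) 0 = 0 :> 'cV_n by elim: r => //= r ->; rewrite mulmx0.
move=> q qN; apply/negP => /eqP hq; move: fN.
by rewrite -(subnK qN) iterD hq z eqxx.
Qed.

End Sl2.

(** * The orthogonal Lie algebra and its Cartan subalgebra *)

(** The commutation relations of the generators E_xy = e_xy - e_yx of so(I). *)
Definition so_relations (F : nzRingType) (I : eqType) n (A : I -> I -> 'M[F]_n) :=
  (forall x y, A x y = - A y x) /\
  (forall x y z w, mxlie (A x y) (A z w) =
     (y == z)%:R *: A x w - (x == z)%:R *: A y w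
     - (y == w)%:R *: A x z + (x == w)%:R *: A y z).

Section SoRelations.
Variables (F : comNzRingType) (I : eqType) (n : nat) (A : I -> I -> 'M[F]_n).
Hypothesis hA : so_relations A.

Lemma soC x y : A x y = - A y x. Proof. by have [+ _] := hA. Qed.

Lemma so_lie_chain x y z : x != y -> y != z -> x != z ->
  mxlie (A x y) (A y z) = A x z.
Proof.
have [_ ->] := hA; rewrite eqxx => /negPf -> /negPf -> /negPf ->.
by rewrite !scale0r scale1r !subr0 addr0.
Qed.

Lemma so_lie_disjoint x y z w : x != z -> x != w -> y != z -> y != w ->
  mxlie (A x y) (A z w) = 0.
Proof.
have [_ ->] := hA => /negPf -> /negPf -> /negPf -> /negPf ->.
by rewrite !scale0r !subr0 addr0.
Qed.

End SoRelations.

Lemma so_diag (F : fieldType) (I : eqType) n (A : I -> I -> 'M[F]_n) x :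
  so_relations A -> 2%:R != 0 :> F -> A x x = 0.
Proof.
move=> hA two; apply/eqP; have /eqP := soC hA x x.
by rewrite -addr_eq0 -mulr2n -scaler_nat scaler_eq0 (negPf two).
Qed.

(** Coordinates of a space of dimension 2r + 1: [Some (k, false)] and
[Some (k, true)] span the k-th Cartan plane, and [None] is the remaining one. *)
Definition idx r := option ('I_r * bool).

Section Weights.
Variables (C : numClosedFieldType) (r n : nat) (A : idx r -> idx r -> 'M[C]_n).
Hypothesis hA : so_relations A.
Implicit Types (k l : 'I_r) (s : int) (mu al : 'rV[int]_r) (v : 'cV[C]_n).

(** The factor 2i makes the eigenvalues integers: they are twice the usual
weights. *)
Definition cartan k : 'M[C]_n := (2%:R * 'i) *: A (Some (k, false)) (Some (k, true)).

Definition has_degree al (X : 'M[C]_n) :=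
  forall k, mxlie (cartan k) X = (al 0 k)%:~R *: X.

Definition weight_vector mu v := forall k, cartan k *m v = (mu 0 k)%:~R *: v.

Definition is_weight mu := exists2 v, v != 0 & weight_vector mu v.

Lemma degree_weight al mu X v :
  has_degree al X -> weight_vector mu v -> weight_vector (mu + al) (X *m v).
Proof.
move=> hX hv k; rewrite mxlie_apply hX hv -scalemxAr -scalemxAl -scalerDl.
by rewrite mxE intrD addrC.
Qed.

Lemma degree_iter_weight al mu X v p :
  has_degree al X -> weight_vector mu v ->
  weight_vector (mu + al *+ p) (iter p (mulmx X) v).
Proof.
move=> hX hv; elim: p => [|p IH] /=; first by rewrite mulr0n addr0.
by rewrite mulrSr addrA; apply: degree_weight.
Qed.

(** A root vector for the short root s e_k, where s is 1 or -1. *)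
Definition short_vector k s : 'M[C]_n :=
  A (Some (k, false)) None - (s%:~R * 'i) *: A (Some (k, true)) None.

(** A root vector for the long root s (e_k - e_l), where s is 1 or -1. *)
Definition long_vector k l s : 'M[C]_n :=
  A (Some (k, false)) (Some (l, false)) + A (Some (k, true)) (Some (l, true))
  - (s%:~R * 'i) *: (A (Some (k, true)) (Some (l, false))
                     - A (Some (k, false)) (Some (l, true))).

Let idxE k l (b c : bool) :
  (Some (k, b) == Some (l, c) :> idx r) = (k == l) && (b == c).
Proof. by []. Qed.

Let idxN (x : 'I_r * bool) : ((Some x == None :> idx r) = false) *
  ((None == Some x :> idx r) = false).
Proof. by []. Qed.

Let ii := mulCii C.

Lemma cartan_commute k l : mxlie (cartan k) (cartan l) = 0.
Proof.
have [->|kl] := eqVneq k l; first by rewrite /mxlie subrr.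
rewrite mxlieZl mxlieZr so_lie_disjoint ?scaler0 // idxE negb_and ?kl //.
Qed.

Let soxx x : A x x = 0. Proof. by rewrite (so_diag _ hA) ?pnatr_eq0. Qed.

Let entrywise := (mxlieDr, mxlieDl, mxlieNr, mxlieNl, mxlieZr, mxlieZl).

Lemma short_vector_degree k s :
  s * s = 1 -> has_degree (2%:Z *: (s *: delta_mx 0 k)) (short_vector k s).
Proof.
move=> ss l; rewrite !mxE eqxx /= !intrM.
have ss' : s%:~R * s%:~R = 1 :> C by rewrite -intrM ss.
rewrite !entrywise; have [_ rel] := hA; rewrite !rel !idxE !idxN.
have [->|_] := eqVneq l k; apply/matrixP => p q; rewrite !mxE /= ?mulr0z ?mulr1z;
  last by ring.
ring: ss' ii.
Qed.

Lemma short_vector_lie k :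
  mxlie (short_vector k 1) (short_vector k (-1)) = - cartan k.
Proof.
rewrite !entrywise; have [_ rel] := hA; rewrite !rel !idxE !idxN eqxx.
rewrite (soC hA (Some (k, true)) (Some (k, false))) !soxx.
by apply/matrixP => p q; rewrite !mxE /=; ring: ii.
Qed.

Lemma long_vector_degree k l s : k != l -> s * s = 1 ->
  has_degree (2%:Z *: (s *: (delta_mx 0 k - delta_mx 0 l))) (long_vector k l s).
Proof.
move=> kl ss m; rewrite !mxE eqxx /= !intrM.
have ss' : s%:~R * s%:~R = 1 :> C by rewrite -intrM ss.
rewrite !entrywise; have [_ rel] := hA; rewrite !rel !idxE.
have lk : l == k = false by rewrite eq_sym (negPf kl).
have [->|mk] := eqVneq m k.
  rewrite (negPf kl); apply/matrixP => p q; rewrite !mxE /= ?intrB ?mulr0z ?mulr1z.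
  ring: ss' ii.
have [->|ml] := eqVneq m l; apply/matrixP => p q;
  rewrite !mxE /= ?intrB ?mulr0z ?mulr1z; last by ring.
have flip b c : A (Some (l, b)) (Some (k, c)) = - A (Some (k, c)) (Some (l, b)).
  exact: soC.
rewrite !flip !mxE.
ring: ss' ii.
Qed.

Lemma long_vector_lie k l : k != l ->
  mxlie (long_vector k l 1) (long_vector k l (-1))
  = (-2%:R) *: (cartan k - cartan l).
Proof.
move=> kl.
have lk : l == k = false by rewrite eq_sym (negPf kl).
rewrite !entrywise; have [_ rel] := hA; rewrite !rel !idxE !eqxx (negPf kl) lk.
rewrite (soC hA (Some (k, true)) (Some (k, false))).
rewrite (soC hA (Some (l, true)) (Some (l, false))) !soxx.
apply/matrixP => p q; rewrite !mxE /=.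
ring: ii.
Qed.

End Weights.

(** * Strings of weights *)

Section WeightStrings.
Variables (C : numClosedFieldType) (r n : nat) (A : idx r -> idx r -> 'M[C]_n).
Implicit Types (k l : 'I_r) (s j m : int) (mu al : 'rV[int]_r) (v : 'cV[C]_n).

(** The string of [sl2_string] is used from both ends: the one that comes down
from a highest weight covers 0 <= j <= m, and the one that goes up from a lowest
weight, for the triple (- h, f, e), covers m <= j <= 0. *)
Lemma weight_string al e f (h : 'M[C]_n) (c kap : C) mu :
  has_degree A al e -> has_degree A (- al) f ->
  mxlie h e = e -> mxlie h f = - f -> mxlie e f = kap *: h -> kap != 0 ->
  (forall v, weight_vector A mu v -> h *m v = c *: v) -> is_weight A mu ->
  exists m, 2%:R * c = m%:~R /\
    forall j, (0 <= j <= m) || (m <= j <= 0) -> is_weight A (mu - j *: al).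
Proof.
move=> de df he hf ef kap0 hc [v v0 hv].
have [p [N [pN up]]] := sl2_string he hf ef kap0 (hc v hv) v0.
have fe : mxlie f e = kap *: - h by rewrite mxlieC ef scalerN.
have hf' : mxlie (- h) f = f by rewrite mxlieNl hf opprK.
have he' : mxlie (- h) e = - e by rewrite mxlieNl he.
have hv' : (- h) *m v = (- c) *: v by rewrite mulNmx hc // scaleNr.
have [p' [N' [pN' down]]] := sl2_string hf' he' fe kap0 hv' v0.
have mE : 2%:R * c = (N%:Z - 2%:Z * p%:Z)%:~R.
  by rewrite intrB intrM /= -[N%:Z%:~R]pN -[p%:Z%:~R]/(p%:R); ring.
have mE' : 2%:R * c = (2%:Z * p'%:Z - N'%:Z)%:~R.
  by rewrite intrB intrM /= -[N'%:Z%:~R]pN' -[p'%:Z%:~R]/(p'%:R); ring.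
have mm : (N%:Z - 2%:Z * p%:Z)%R = (2%:Z * p'%:Z - N'%:Z)%R.
  by apply: (@intr_inj C); rewrite -mE -mE'.
exists (N%:Z - 2%:Z * p%:Z); split=> // j /orP [/andP[j0 jm]|/andP[mj j0]].
  have [q jq] : exists q : nat, j = q%:Z by exists `|j|%N; lia.
  exists (iter (p + q) (mulmx f) (iter p (mulmx e) v)); first by apply: up; lia.
  have := degree_iter_weight (p + q) df (degree_iter_weight p de hv).
  rewrite -addrA mulNrn mulrnDr opprD addNKr.
  by rewrite jq -natz scaler_nat.
have [q jq] : exists q : nat, j = - q%:Z by exists `|j|%N; lia.
exists (iter (p' + q) (mulmx e) (iter p' (mulmx f) v)); first by apply: down; lia.
have := degree_iter_weight (p' + q) de (degree_iter_weight p' df hv).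
rewrite -addrA mulNrn mulrnDr addKr.
by rewrite jq scaleNr opprK -natz scaler_nat.
Qed.

End WeightStrings.

Section Strings.
Variables (C : numClosedFieldType) (r n : nat) (A : idx r -> idx r -> 'M[C]_n).
Hypothesis hA : so_relations A.
Implicit Types (k l : 'I_r) (s j m : int) (mu nu : 'rV[int]_r) (v : 'cV[C]_n).

Let two_neq0 : 2%:R != 0 :> C. Proof. by rewrite pnatr_eq0. Qed.

Let short_e k : has_degree A (2%:Z *: delta_mx 0 k) (short_vector A k 1).
Proof. by rewrite -[delta_mx 0 k]scale1r; apply: short_vector_degree. Qed.

Let short_f k : has_degree A (- (2%:Z *: delta_mx 0 k)) (short_vector A k (-1)).
Proof. by rewrite -scalerN -scaleN1r; apply: short_vector_degree. Qed.

Let short_h k := 2%:R^-1 *: cartan A k.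

Let short_he k : mxlie (short_h k) (short_vector A k 1) = short_vector A k 1.
Proof.
by rewrite mxlieZl short_e scalerA !mxE !eqxx mulr1 mulVf // scale1r.
Qed.

Let short_hf k : mxlie (short_h k) (short_vector A k (-1)) = - short_vector A k (-1).
Proof.
rewrite mxlieZl short_f scalerA !mxE !eqxx mulr1.
by rewrite [_%:~R](_ : _ = - 2%:R) // mulrN mulVf // scaleN1r.
Qed.

Let short_ef k : mxlie (short_vector A k 1) (short_vector A k (-1))
  = (- 2%:R) *: short_h k.
Proof. by rewrite short_vector_lie // scalerA mulNr divff // scaleN1r. Qed.

Lemma short_string mu k j :
  is_weight A mu -> (0 <= j <= mu 0 k) || (mu 0 k <= j <= 0) ->
  is_weight A (mu - j *: (2%:Z *: delta_mx 0 k)).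
Proof.
move=> hmu.
have [|||m [me hm]] := @weight_string C r n A _ _ _ (short_h k)
  (2%:R^-1 * (mu 0 k)%:~R) _ mu (short_e k) (short_f k) (short_he k)
  (short_hf k) (short_ef k).
- by rewrite oppr_eq0.
- by move=> v hv; rewrite -scalemxAl hv scalerA.
- exact: hmu.
suff -> : mu 0 k = m by exact: hm.
by move: me; rewrite mulrA divff // mul1r => /intr_inj.
Qed.

Lemma long_string mu k l : k != l -> is_weight A mu ->
  exists m, mu 0 k - mu 0 l = 2%:Z * m /\
    forall j, (0 <= j <= m) || (m <= j <= 0) ->
      is_weight A (mu - j *: (2%:Z *: (delta_mx 0 k - delta_mx 0 l))).
Proof.
move=> kl hmu.
have lk : l == k = false by rewrite eq_sym (negPf kl).
have f4 : 4%:R != 0 :> C by rewrite pnatr_eq0.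
pose h := 4%:R^-1 *: (cartan A k - cartan A l).
pose al : 'rV[int]_r := 2%:Z *: (delta_mx 0 k - delta_mx 0 l).
have de : has_degree A al (long_vector A k l 1).
  by rewrite /al -[_ - _]scale1r; apply: long_vector_degree.
have df : has_degree A (- al) (long_vector A k l (-1)).
  by rewrite /al -scalerN -scaleN1r; apply: long_vector_degree.
have he : mxlie h (long_vector A k l 1) = long_vector A k l 1.
  rewrite mxlieZl mxlieDl mxlieNl !de -scalerBl scalerA !mxE !eqxx lk (negPf kl) /=.
  by rewrite -intrB [_%:~R](_ : _ = 4%:R :> C) ?mulVf ?scale1r.
have hf : mxlie h (long_vector A k l (-1)) = - long_vector A k l (-1).
  rewrite mxlieZl mxlieDl mxlieNl !df -scalerBl scalerA !mxE !eqxx lk (negPf kl) /=.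
  by rewrite -intrB [_%:~R](_ : _ = - 4%:R :> C) ?mulrN ?mulVf ?scaleN1r.
have ef : mxlie (long_vector A k l 1) (long_vector A k l (-1)) = (- 8%:R) *: h.
  rewrite long_vector_lie // scalerA; congr (_ *: _).
  by rewrite mulNr; congr (- _); rewrite (natrM _ 2 4) mulfK.
have [|||m [me hm]] := @weight_string C r n A al _ _ h
  (4%:R^-1 * (mu 0 k - mu 0 l)%:~R) _ mu de df he hf ef.
- by rewrite oppr_eq0 pnatr_eq0.
- by move=> v hv; rewrite -scalemxAl mulmxBl !hv -scalerBl scalerA intrB.
- exact: hmu.
exists m; split=> //; apply: (@intr_inj C); rewrite intrM -me.
by rewrite !mulrA -natrM divff // mul1r.
Qed.

Lemma weight_exists : (0 < n)%N -> exists mu, is_weight A mu.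
Proof.
move=> n0.
have [|v v0 /allP hv] := @common_eigenvector C n [seq (cartan A k)^T | k : 'I_r] n0.
  move=> _ _ /mapP [k _ ->] /mapP [l _ ->]; apply/eqP.
  rewrite /comm_mxb /= -!trmx_mul (inj_eq trmx_inj) eq_sym -subr_eq0.
  by rewrite [_ - _](cartan_commute hA).
have vT0 : v^T != 0 by rewrite -(inj_eq trmx_inj) trmxK trmx0.
have /fin_all_exists [m hm] k : exists m : int, cartan A k *m v^T = m%:~R *: v^T.
  have /sub_rVP [a va] : stablemx v (cartan A k)^T by apply/hv/map_f/mem_enum.
  have av : cartan A k *m v^T = a *: v^T.
    by apply: trmx_inj; rewrite trmx_mul trmxK va; apply/matrixP => p q; rewrite !mxE.
  have hv' : short_h k *m v^T = (2%:R^-1 * a) *: v^T.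
    by rewrite -scalemxAl av scalerA.
  have [|p [N [pN _]]] := sl2_string (short_he k) (short_hf k) (short_ef k) _ hv' vT0.
    by rewrite oppr_eq0.
  exists (N%:Z - 2%:Z * p%:Z); rewrite av; congr (_ *: _).
  rewrite intrB intrM /= -[N%:Z%:~R]pN -[p%:Z%:~R]/(p%:R).
  by rewrite mulrDr mulrA divff // mul1r addrK.
by exists (\row_k m k), v^T => // k; rewrite hm mxE.
Qed.

(** Strings along the short roots change one coordinate at a time. *)
Lemma weight_box mu nu :
  is_weight A mu ->
  (forall k, (`|nu 0 k| <= `|mu 0 k|)%R /\ (2 %| (mu 0 k - nu 0 k)%R)%Z) ->
  is_weight A nu.
Proof.
move=> hmu hnu.
suff H (s : seq 'I_r) : is_weight A (\row_k if k \in s then nu 0 k else mu 0 k).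
  have := H (enum 'I_r); congr (is_weight A _); apply/rowP => k.
  by rewrite mxE mem_enum.
elim: s => [|k s IH].
  by move: hmu; congr (is_weight A _); apply/rowP => k; rewrite mxE.
have [ks|ks] := boolP (k \in s).
  move: IH; congr (is_weight A _); apply/rowP => l; rewrite !mxE inE.
  by case: eqP => [->|]; rewrite ?ks.
have [le /dvdzP [j jE]] := hnu k.
have := @short_string _ k j IH; rewrite mxE (negPf ks) => H.
have : is_weight A (\row_k0 (if k0 \in s then nu 0 k0 else mu 0 k0)
         - j *: (2%:Z *: delta_mx 0 k)) by apply: H; lia.
congr (is_weight A _); apply/rowP => l; rewrite !mxE inE eqxx /=.
have [->|_] := eqVneq l k; last by rewrite /= !mulr0 subr0.
by rewrite (negPf ks) /=; lia.
Qed.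

End Strings.

(** * The two possible sets of weights in dimension 16 *)

Section Dichotomy.
Variables (C : numClosedFieldType) (A : idx 4 -> idx 4 -> 'M[C]_16).
Hypothesis hA : so_relations A.
Implicit Types (k l m : 'I_4) (s t j : int) (mu nu : 'rV[int]_4) (v : 'cV[C]_16).

(** One number that separates the weights that matter: those with coordinates
in {-1, 1}, and those with coordinates in {-2, 0, 2}. *)
Definition ternary mu : int := \sum_(k < 4) 3%:Z ^+ k * mu 0 k.

Definition ternary_mx : 'M[C]_16 := \sum_(k < 4) (3%:R ^+ k) *: cartan A k.

Lemma ternary_weight mu v :
  weight_vector A mu v -> ternary_mx *m v = (ternary mu)%:~R *: v.
Proof.
move=> hv; rewrite /ternary_mx mulmx_suml rmorph_sum scaler_suml.
apply: eq_bigr => k _; rewrite -scalemxAl hv scalerA.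
by rewrite rmorphM rmorphXn.
Qed.

Lemma size_weights (mus : seq 'rV[int]_4) :
  uniq (map ternary mus) -> (forall mu, mu \in mus -> is_weight A mu) ->
  (size mus <= 16)%N.
Proof.
move=> um hm.
rewrite -(size_map (fun mu => (ternary mu)%:~R : C)).
apply: (@size_eigenvalues _ _ ternary_mx).
  by rewrite (map_comp intr ternary) map_inj_uniq //; apply: intr_inj.
move=> _ /mapP [mu /hm [v v0 hv] ->]; exists v => //; exact: ternary_weight.
Qed.

Let pair_weight k l : 'rV[int]_4 := 2%:Z *: (delta_mx 0 k + delta_mx 0 l).

Let pair_weight_move k l m : k != l -> k != m ->
  is_weight A (pair_weight k l) -> is_weight A (pair_weight k m).
Proof.
move=> kl km hw; have [<- //|lm] := eqVneq l m.
have [j []] := long_string hA lm hw.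
rewrite !mxE !eqxx /= !(eq_sym l) !(eq_sym m) (negPf kl) (negPf km) (negPf lm) /=.
move=> j1 /(_ 1); have -> : j = 1 by lia.
move=> /(_ isT); congr (is_weight A _).
by rewrite scale1r -scalerBr opprB addrACA subrr addr0.
Qed.

Let pair_weightC k l : pair_weight k l = pair_weight l k.
Proof. by rewrite /pair_weight addrC. Qed.

Let pair_weight_any k l k' l' : k != l -> k' != l' ->
  is_weight A (pair_weight k l) -> is_weight A (pair_weight k' l').
Proof.
move=> kl kl' hw.
have [kk|kk] := eqVneq k k'; first by apply: (pair_weight_move (l := l)); rewrite -?kk // kk.
apply: (pair_weight_move (l := k)) => //; first by rewrite eq_sym.
by rewrite pair_weightC; apply: pair_weight_move hw.
Qed.

(** Strings move a weight with two nonzero even coordinates to 2(e_0 + e_l) for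
l = 1, 2, 3.  Then s and t in {-1, 0, 1} give 18 distinct weights
2(s e_0 + t e_l) with t nonzero, too many for dimension 16. *)
Lemma weight_not_two mu k l :
  k != l -> is_weight A mu -> (forall m, (2 %| mu 0%R m)%Z) ->
  mu 0 k = 0 \/ mu 0 l = 0.
Proof.
move=> kl hmu ev.
have [|k0] := eqVneq (mu 0 k) 0; first by left.
have [|l0] := eqVneq (mu 0 l) 0; first by right.
exfalso.
have hkl : is_weight A (pair_weight k l).
  apply: weight_box hmu _ => // m; rewrite !mxE /=.
  have := ev m; have := ev k; have := ev l.
  have [->|mk] := eqVneq m k; first by rewrite (negPf kl); lia.
  have [->|ml] := eqVneq m l; lia.
pose o i (lt : (i < 4)%N) := Ordinal lt.
pose w (x : int * (int * 'I_4)) : 'rV[int]_4 :=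
  2%:Z *: (x.1 *: delta_mx 0 ord0 + x.2.1 *: delta_mx 0 x.2.2).
pose ls := [:: o 1%N isT; o 2%N isT; o 3%N isT].
pose xs :=
  [seq (s, tm) | s <- [:: -1; 0; 1], tm <- [seq (t, m) | t <- [:: -1; 1], m <- ls]].
suff : (size (map w xs) <= 16)%N by rewrite size_map.
apply: size_weights.
  rewrite -map_comp.
  (* The closed form makes the list of values computable. *)
  rewrite (@eq_map _ _ _ (fun x : int * (int * 'I_4) =>
             2%:Z * (x.1 + 3%:Z ^+ x.2.2 * x.2.1))) //.
  case=> s [t m] /=; rewrite /ternary !big_ord_recl big_ord0 !mxE /= /bump /=.
  by case: m => [[|[|[|[|m]]]] lt] //=; ring.
move=> _ /mapP [x xin ->].
have {hkl} hx m : m != ord0 -> is_weight A (pair_weight ord0 m).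
  by rewrite eq_sym => m0; apply: pair_weight_any hkl.
have /andP[/andP[x1 x2] x3] : (`|x.1| <= 1) && (`|x.2.1| <= 1) && (x.2.2 != ord0).
  by move: x xin; apply/allP.
apply: weight_box (hx _ x3) _ => // m; rewrite !mxE /=.
move: x3; rewrite eq_sym; move: (x.1) (x.2.1) (x.2.2) x1 x2 => s t q s1 t1 q0.
have [->|m0] := eqVneq m ord0.
  by case: eqP => [e|_ /=]; [rewrite e eqxx in q0|lia].
by case: (m == q) => /=; lia.
Qed.

Definition signs (d : {ffun 'I_4 -> bool}) : 'rV[int]_4 := \row_k (-1) ^+ d k.

(** Strings along long roots force all coordinates of a weight to have the same
parity. *)
Lemma weights_dichotomy :
  (forall d, is_weight A (signs d)) \/
  is_weight A 0 /\ forall mu k l, k != l -> is_weight A mu ->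
                     mu 0 k = 0 \/ mu 0 l = 0.
Proof.
have [[mu [hmu [k ok]]]|ev] :=
  pselect (exists mu, is_weight A mu /\ exists k, ~~ (2 %| mu 0%R k)%Z).
  left=> d; apply: (weight_box hA (mu := mu)) => // l; rewrite mxE.
  have ol : ~~ (2 %| mu 0%R l)%Z.
    have [<- //|kl] := eqVneq k l.
    by have [m [hm _]] := long_string hA kl hmu; lia.
  case: (d l) => /=; rewrite ?expr0 ?expr1; lia.
have ev' mu : is_weight A mu -> forall m, (2 %| mu 0%R m)%Z.
  by move=> hmu m; apply/negPn/negP => om; apply: ev; exists mu; split=> //; exists m.
right; split; last by move=> mu k l kl hmu; exact: (weight_not_two kl hmu (ev' _ hmu)).
have [//|mu hmu] := weight_exists hA; have even_mu := ev' _ hmu.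
by apply: weight_box (hmu) _ => // k; rewrite mxE; have := even_mu k; lia.
Qed.

End Dichotomy.

(** * Weight zero *)

Section ZeroWeight.
Variables (C : numClosedFieldType) (r n : nat) (A : idx r -> idx r -> 'M[C]_n).
Hypothesis hA : so_relations A.
Implicit Types (k l : 'I_r) (s : int) (mu : 'rV[int]_r) (v : 'cV[C]_n).

Definition off_pair k (x : idx r) := if x is Some (l, _) then k != l else true.

Lemma cartan_off_pair k x y v : off_pair k x -> off_pair k y ->
  cartan A k *m (A x y *m v) = A x y *m (cartan A k *m v).
Proof.
move=> kx ky; rewrite mxlie_apply mxlieZl so_lie_disjoint // ?scaler0 ?mul0mx ?add0r //.
- by case: x kx => [[l b]|] //=; apply: contraNneq => -[->].
- by case: y ky => [[l b]|] //=; apply: contraNneq => -[->].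
- by case: x kx => [[l b]|] //=; apply: contraNneq => -[->].
- by case: y ky => [[l b]|] //=; apply: contraNneq => -[->].
Qed.

Lemma cartan_on_pair k b y : off_pair k y ->
  mxlie (cartan A k) (A (Some (k, b)) y)
  = ((-1) ^+ (~~ b) * (2%:R * 'i)) *: A (Some (k, ~~ b)) y.
Proof.
move=> ky; have ne c : Some (k, c) != y.
  by case: y ky => [[l c']|] //=; apply: contraNneq => -[->].
have ft c : Some (k, c) != Some (k, ~~ c) :> idx r by case: c; apply/eqP => -[].
rewrite mxlieZl; case: b => /=.
  by rewrite so_lie_chain ?(ft false) // ?expr0 ?mul1r.
rewrite (soC hA (Some (k, false)) (Some (k, true))) mxlieNl.
rewrite so_lie_chain ?(ft true) //.
by rewrite scalerN expr1 mulN1r scaleNr.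
Qed.

Lemma cartan_sq k b y v : off_pair k y -> cartan A k *m v = 0 ->
  cartan A k *m (cartan A k *m (A (Some (k, b)) y *m v))
  = 4%:R *: (A (Some (k, b)) y *m v).
Proof.
move=> ky hv; have step c : cartan A k *m (A (Some (k, c)) y *m v)
  = ((-1) ^+ (~~ c) * (2%:R * 'i)) *: (A (Some (k, ~~ c)) y *m v).
  by rewrite mxlie_apply hv mulmx0 addr0 cartan_on_pair // scalemxAl.
rewrite step -scalemxAr step scalerA negbK; congr (_ *: _).
have ii := mulCii C.
by case: b; rewrite /= !expr0 ?expr1; ring: ii.
Qed.

Lemma sq_eigenvector (h : 'M[C]_n) v : v != 0 -> h *m (h *m v) = 4%:R *: v ->
  exists (s : int) (a b : C) w,
    [/\ s != 0, w != 0, w = a *: (h *m v) + b *: v & h *m w = s%:~R *: w].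
Proof.
move=> v0 hv; pose w := 1 *: (h *m v) + 2%:R *: v.
have [w0|w0] := eqVneq w 0.
  exists (-2), 0, 1, v; split=> //; first by rewrite scale0r scale1r add0r.
  by move/eqP: w0; rewrite /w scale1r addr_eq0 -scaleNr => /eqP.
exists 2, 1, 2%:R, w; split=> //; rewrite /w !scale1r mulmxDr hv -scalemxAr.
by rewrite scalerDr scalerA -natrM addrC.
Qed.

(** A nonzero v of this kind has a component that is an eigenvector of
[cartan A k] and [cartan A l] with eigenvalues 2 or -2. *)
Lemma zero_weight_vanish (k l : 'I_r) v : k != l ->
  (forall mu, is_weight A mu -> mu 0 k = 0 \/ mu 0 l = 0) ->
  cartan A k *m (cartan A k *m v) = 4%:R *: v ->
  cartan A l *m (cartan A l *m v) = 4%:R *: v ->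
  (forall m, m != k -> m != l -> cartan A m *m v = 0) -> v = 0.
Proof.
move=> kl no hk hl hm; apply/eqP/negPn/negP => v0.
have com i j (u : 'cV[C]_n) : cartan A i *m (cartan A j *m u) = cartan A j *m (cartan A i *m u).
  by rewrite mxlie_apply cartan_commute // mul0mx add0r.
have [s [a [b [w [s0 w0 wE ws]]]]] := sq_eigenvector v0 hk.
have wl : cartan A l *m (cartan A l *m w) = 4%:R *: w.
  rewrite wE !mulmxDr -!scalemxAr (com l k v) (com l k _) hl -!scalemxAr.
  by rewrite scalerDr !scalerA (mulrC 4%:R) (mulrC b).
have wm m : m != k -> m != l -> cartan A m *m w = 0.
  by move=> mk ml; rewrite wE mulmxDr -!scalemxAr com !hm // mulmx0 !scaler0 addr0.
have [t [a' [b' [u [t0 u0 uE ut]]]]] := sq_eigenvector w0 wl.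
have uk : cartan A k *m u = s%:~R *: u.
  rewrite uE mulmxDr -!scalemxAr com ws -!scalemxAr scalerDr !scalerA.
  by rewrite (mulrC a') (mulrC b').
have um m : m != k -> m != l -> cartan A m *m u = 0.
  by move=> mk ml; rewrite uE mulmxDr -!scalemxAr com !wm // mulmx0 !scaler0 addr0.
pose mu : 'rV[int]_r := \row_m (if m == k then s else if m == l then t else 0).
have [||] := no mu.
- exists u => // m; rewrite mxE.
  have [->//|mk] := eqVneq m k; have [->//|ml] := eqVneq m l.
  by rewrite um // scale0r.
- by rewrite mxE eqxx => s1; rewrite s1 in s0.
- by rewrite mxE eq_sym (negPf kl) eqxx => t1; rewrite t1 in t0.
Qed.

(** Both kinds of products applied to a vector of weight 0 satisfy the
hypotheses of [zero_weight_vanish]: they move two distinct Cartan planes. *)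
Lemma zero_weight_vector :
  is_weight A 0 ->
  (forall mu k l, k != l -> is_weight A mu -> mu 0 k = 0 \/ mu 0 l = 0) ->
  exists v, [/\ v != 0, forall x y, A (Some x) (Some y) *m v = 0 &
    forall k b l c, k != l -> A (Some (k, b)) None *m (A (Some (l, c)) None *m v) = 0].
Proof.
move=> [v v0 hv] no; exists v.
have {}hv k : cartan A k *m v = 0 by rewrite hv mxE scale0r.
split=> //.
  move=> [k b] [l c]; have [<-|kl] := eqVneq k l.
    case: b; case: c.
    - by rewrite so_diag ?mul0mx ?pnatr_eq0.
    - rewrite soC // mulNmx; apply/eqP; rewrite oppr_eq0; apply/eqP.
      have /eqP := hv k; rewrite -scalemxAl scaler_eq0 mulf_eq0 pnatr_eq0.
      by rewrite (negPf (neq0Ci C)) /= => /eqP.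
    - have /eqP := hv k; rewrite -scalemxAl scaler_eq0 mulf_eq0 pnatr_eq0.
      by rewrite (negPf (neq0Ci C)) /= => /eqP.
    - by rewrite so_diag ?mul0mx ?pnatr_eq0.
  apply: (zero_weight_vanish kl) => [mu|||m mk ml]; first exact: no.
  - by rewrite cartan_sq.
  - rewrite [A _ _](soC hA) mulNmx !mulmxN scalerN; congr (- _).
    by rewrite cartan_sq //= eq_sym.
  - by rewrite cartan_off_pair //= hv mulmx0.
move=> k b l c kl; apply: (zero_weight_vanish kl) => [mu|||m mk ml]; first exact: no.
- by rewrite cartan_sq // cartan_off_pair // hv mulmx0.
- have lk : off_pair l (Some (k, b)) by rewrite /= eq_sym.
  by rewrite !(cartan_off_pair _ lk (isT : off_pair l None)) // cartan_sq // -scalemxAr.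
- by rewrite !cartan_off_pair //= hv !mulmx0.
Qed.

End ZeroWeight.

(** * A basis of eigenvectors *)

Section Eigenbasis.
Variables (F : fieldType) (n : nat) (T : finType).
Variables (h : 'M[F]_n.+1) (d : T -> F) (u : T -> 'cV[F]_n.+1).
Hypotheses (d_inj : injective d) (u_neq0 : forall t, u t != 0).
Hypothesis hu : forall t, h *m u t = d t *: u t.

Lemma horner_mx_eigenvector (p : {poly F}) t :
  horner_mx h p *m u t = p.[d t] *: u t.
Proof.
elim/poly_ind: p => [|p c IH]; first by rewrite rmorph0 mul0mx horner0 scale0r.
rewrite rmorphD rmorphM /= horner_mx_X horner_mx_C -[_ * h]/(_ *m h) mulmxDl -mulmxA hu.
by rewrite -scalemxAr IH mul_scalar_mx scalerA hornerMXaddC scalerDl mulrC.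
Qed.

(** The Lagrange polynomial that vanishes at the other eigenvalues isolates one
coefficient. *)
Lemma eigenvectors_free (x : T -> F) :
  \sum_t x t *: u t = 0 -> forall t, x t = 0.
Proof.
move=> xu s; pose p := \prod_(t | t != s) ('X - (d t)%:P).
have : horner_mx h p *m (\sum_t x t *: u t) = 0 by rewrite xu mulmx0.
rewrite mulmx_sumr (bigD1 s) //= big1 ?addr0 => [|t ts].
  rewrite -scalemxAr horner_mx_eigenvector scalerA => /eqP.
  rewrite scaler_eq0 (negPf (u_neq0 s)) orbF mulf_eq0 => /orP[/eqP //|].
  rewrite horner_prod prodf_seq_eq0 => /hasP [t _ /andP[ts]].
  by rewrite hornerXsubC subr_eq0 => /eqP /d_inj st; rewrite st eqxx in ts.
rewrite -scalemxAr horner_mx_eigenvector horner_prod (bigD1 t) //= hornerXsubC.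
by rewrite subrr mul0r scale0r scaler0.
Qed.

Lemma eigenvectors_span : #|T| = n.+1 ->
  forall v, exists x : T -> F, v = \sum_t x t *: u t.
Proof.
move=> cT v; pose M := \matrix_(i < #|T|) (u (enum_val i))^T.
have mulM (y : 'rV_#|T|) : (y *m M)^T = \sum_t y 0 (enum_rank t) *: u t.
  rewrite mulmx_sum_row linear_sum (reindex enum_rank) /=; last exact: onW_bij (enum_rank_bij _).
  by apply: eq_bigr => t _; rewrite linearZ /= rowK trmxK enum_rankK.
have freeM : row_free M.
  apply: inj_row_free => y yM; apply/rowP => i; rewrite mxE -(enum_valK i).
  apply: (eigenvectors_free (x := fun t => y 0 (enum_rank t))).
  by rewrite -mulM yM trmx0.
have : (v^T <= M)%MS by apply: submx_full; rewrite /row_full (eqP freeM) cT.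
case/submxP => y vy; exists (fun t => y 0 (enum_rank t)).
by rewrite -mulM -vy trmxK.
Qed.

End Eigenbasis.

Lemma signs_inj : injective signs.
Proof.
move=> d e de; apply/ffunP => k; have := congr1 (fun f : 'rV_4 => f 0 k) de.
by rewrite !mxE; case: (d k); case: (e k).
Qed.

Lemma ternary_signs_inj : injective (fun d => ternary (signs d)).
Proof.
move=> d e; rewrite /ternary !big_ord_recl !big_ord0 !mxE => de.
apply/ffunP; suff H : [/\ d ord0 = e ord0, d (lift ord0 ord0) = e (lift ord0 ord0),
    d (lift ord0 (lift ord0 ord0)) = e (lift ord0 (lift ord0 ord0)) &
    d (lift ord0 (lift ord0 (lift ord0 ord0))) = e (lift ord0 (lift ord0 (lift ord0 ord0)))].
  case: H => h0 h1 h2 h3 [[|[|[|[|m]]]] lt] //.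
  - by rewrite (_ : Ordinal lt = ord0) //; apply: val_inj.
  - by rewrite (_ : Ordinal lt = lift ord0 ord0) //; apply: val_inj.
  - by rewrite (_ : Ordinal lt = lift ord0 (lift ord0 ord0)) //; apply: val_inj.
  - by rewrite (_ : Ordinal lt = lift ord0 (lift ord0 (lift ord0 ord0))) //; apply: val_inj.
move: de; do 4! (case: (d _); case: (e _)) => //.
Qed.

(** * Sign vectors and the action of the generators *)

Definition flip r (k : 'I_r) (d : {ffun 'I_r -> bool}) : {ffun 'I_r -> bool} :=
  [ffun m => d m (+) (m == k)].

Definition opp r (d : {ffun 'I_r -> bool}) : {ffun 'I_r -> bool} :=
  [ffun m => ~~ d m].

Definition touches r (x : idx r) (m : 'I_r) :=
  if x is Some (k, _) then m == k else false.

Definition toggle r (x : idx r) (d : {ffun 'I_r -> bool}) :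
  {ffun 'I_r -> bool} := [ffun m => d m (+) touches x m].

Definition agreement r (d e : {ffun 'I_r -> bool}) : nat :=
  \sum_m (d m == e m).

Lemma sum_touches r (x : idx r) : (\sum_m touches x m = isSome x)%N.
Proof.
case: x => [[k b]|] /=; last by rewrite big1.
by rewrite (bigD1 k) //= eqxx big1 // => m /negPf ->.
Qed.

Lemma toggle_opp r (x y : idx r) (d e : {ffun 'I_r -> bool}) :
  toggle x (toggle y e) = opp d ->
  forall m, (d m == e m) = touches x m (+) touches y m.
Proof.
move=> /ffunP de m; have := de m; rewrite !ffunE.
by case: (d m); case: (e m); case: (touches x m); case: (touches y m).
Qed.

(** * The case of the spin weights *)

Section SpinCase.
Variables (C : numClosedFieldType) (A : idx 4 -> idx 4 -> 'M[C]_16).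
Hypothesis hA : so_relations A.
Hypothesis A_skew : forall x y, (A x y)^T = - A x y.
Local Notation sgn := {ffun 'I_4 -> bool}.
Variable u : sgn -> 'cV[C]_16.
Hypothesis u_neq0 : forall d, u d != 0.
Hypothesis u_weight : forall d, weight_vector A (signs d) (u d).
Implicit Types (d e a b c : sgn) (k l m : 'I_4) (x y : idx 4) (v w : 'cV[C]_16).

Let u_ternary d : ternary_mx A *m u d = (ternary (signs d))%:~R *: u d.
Proof. exact: ternary_weight. Qed.

Let ternary_inj : injective (fun d => (ternary (signs d))%:~R : C).
Proof. by move=> d e /intr_inj /ternary_signs_inj. Qed.

Lemma spin_free (z : sgn -> C) : \sum_d z d *: u d = 0 -> forall d, z d = 0.
Proof. exact: (eigenvectors_free ternary_inj u_neq0 u_ternary). Qed.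

Lemma spin_span v : exists z : sgn -> C, v = \sum_d z d *: u d.
Proof.
apply: (eigenvectors_span ternary_inj u_neq0 u_ternary).
by rewrite card_ffun card_bool card_ord.
Qed.

Lemma weight_coordinates mu (z : sgn -> C) :
  weight_vector A mu (\sum_d z d *: u d) -> forall d, signs d != mu -> z d = 0.
Proof.
move=> hz d; apply: contraNeq => zd; apply/eqP/rowP => k; apply/eqP.
have := hz k; rewrite mulmx_sumr scaler_sumr => /eqP; rewrite -subr_eq0 -sumrB.
rewrite (eq_bigr (fun d => (z d * ((signs d 0 k)%:~R - (mu 0 k)%:~R)) *: u d)).
  move/eqP/spin_free/(_ d)/eqP; rewrite mulf_eq0 (negPf zd) /= subr_eq0.
  by rewrite (inj_eq (@intr_inj C)).
move=> e _; rewrite -scalemxAr u_weight !scalerA -scalerBl mulrBr; congr (_ *: _).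
by rewrite [(mu 0 k)%:~R * _]mulrC.
Qed.

Lemma weight_line d v : weight_vector A (signs d) v -> exists z, v = z *: u d.
Proof.
have [z ->] := spin_span v => hz; exists (z d).
rewrite (bigD1 d) //= big1 ?addr0 // => e ed.
by rewrite (weight_coordinates hz) ?scale0r // (inj_eq signs_inj).
Qed.

Lemma weight_none mu v : (forall d, signs d != mu) -> weight_vector A mu v -> v = 0.
Proof.
have [z ->] := spin_span v => no hz.
by rewrite big1 // => e _; rewrite (weight_coordinates hz) ?scale0r.
Qed.

(** The weight moves by 2s at the place k: either the sign there is flipped, or
the coordinate becomes 3 or -3 and the image is 0. *)
Lemma short_vector_flip k s d : s * s = 1 ->
  exists z, short_vector A k s *m u d = z *: u (flip k d).
Proof.
move=> ss; have := degree_weight (short_vector_degree hA k ss) (u_weight d).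
have s1 : s = 1 \/ s = -1 by nia.
have [sd|sd] := eqVneq s ((-1) ^+ d k).
  move=> hw; exists 0; rewrite scale0r; apply: weight_none hw => e.
  apply/eqP => /rowP /(_ k); rewrite !mxE !eqxx /= mulr1 -sd.
  by case: (e k); rewrite /= ?expr0 ?expr1; lia.
have -> : signs d + 2%:Z *: (s *: delta_mx 0 k) = signs (flip k d).
  apply/rowP => m; rewrite !mxE !ffunE /=.
  have [->|mk] := eqVneq m k; last by rewrite addbF /= !mulr0 addr0.
  by move: sd; case: (d k); rewrite /= ?expr0 ?expr1; lia.
exact: weight_line.
Qed.

Lemma vector_flip k (i : bool) d :
  exists z, A (Some (k, i)) None *m u d = z *: u (flip k d).
Proof.
have [z hz] := @short_vector_flip k 1 d erefl.
have [t ht] := @short_vector_flip k (-1) d erefl.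
have ii := mulCii C.
have two : 2%:R != 0 :> C by rewrite pnatr_eq0.
case: i.
  exists (2%:R^-1 * 'i * (z - t)); rewrite -scalerA scalerBl -hz -ht -mulmxBl.
  rewrite scalemxAl; congr (_ *m _); apply/matrixP => p q; rewrite !mxE.
  by rewrite mulr1z mulrN1z; field: ii.
exists (2%:R^-1 * (z + t)); rewrite -scalerA scalerDl -hz -ht -mulmxDl.
rewrite scalemxAl; congr (_ *m _); apply/matrixP => p q; rewrite !mxE.
by rewrite mulr1z mulrN1z; field.
Qed.

(** The Cartan element of the k-th plane is generated by A_(k,0),None and
A_(k,1),None, and it acts on u_d by a nonzero scalar. *)
Lemma vector_flip_neq0 k d : A (Some (k, false)) None *m u d != 0.
Proof.
apply/negP => /eqP D0.
have D1 : A (Some (k, true)) None *m u d = 0.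
  have := mxlie_apply (cartan A k) (A (Some (k, false)) None) (u d).
  rewrite (u_weight d) -scalemxAr D0 mulmx0 scaler0 addr0 cartan_on_pair //=.
  move/esym/eqP; rewrite -scalemxAl scaler_eq0 mulf_eq0 mulf_eq0 pnatr_eq0.
  by rewrite (negPf (neq0Ci C)) expr1 oppr_eq0 oner_eq0 /= => /eqP.
have := so_lie_chain hA (x := Some (k, false)) (y := None) (z := Some (k, true)) isT isT.
rewrite (soC hA None) mxlieNr => H.
have {}H : A (Some (k, false)) (Some (k, true)) *m u d = 0.
  rewrite -H; last by apply/eqP => -[].
  by rewrite mulNmx /mxlie mulmxBl -!mulmxA D0 D1 !mulmx0 subr0 oppr0.
have := u_weight d k; rewrite -scalemxAl H scaler0 => /esym/eqP.
rewrite scaler_eq0 (negPf (u_neq0 d)) orbF mxE.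
by case: (d k); rewrite /= ?expr0 ?expr1 ?mulrN1z ?mulr1z ?oppr_eq0 oner_eq0.
Qed.

(** A_xy with x and y distinct from [None] is, up to sign, the commutator of
A_x,None and A_y,None, so that the flips at x and y compose. *)
Lemma so_toggle x y d : exists z, A x y *m u d = z *: u (toggle x (toggle y d)).
Proof.
have tN e : toggle None e = e by apply/ffunP => m; rewrite !ffunE addbF.
have tS k i e : toggle (Some (k, i)) e = flip k e by apply/ffunP => m; rewrite !ffunE.
have [<-|xy] := eqVneq x y; first by exists 0; rewrite so_diag ?mul0mx ?scale0r ?pnatr_eq0.
case: x y xy => [[k i]|] [[l j]|] // kl.
- have -> : A (Some (k, i)) (Some (l, j)) =
    - mxlie (A (Some (k, i)) None) (A (Some (l, j)) None).
    by rewrite (soC hA (Some (l, j)) None) mxlieNr opprK so_lie_chain.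
  rewrite !tS; have [z1 h1] := vector_flip l j d; have [z2 h2] := vector_flip k i d.
  have [z3 h3] := vector_flip k i (flip l d); have [z4 h4] := vector_flip l j (flip k d).
  exists (z2 * z4 - z1 * z3).
  have -> : flip k (flip l d) = flip l (flip k d).
    by apply/ffunP => m; rewrite !ffunE addbAC.
  rewrite mulNmx /mxlie mulmxBl -!mulmxA h1 h2 -!scalemxAr h3 h4 !scalerA opprB scalerBl.
  by congr (_ - _ *: u _); apply/ffunP => m; rewrite !ffunE addbAC.
- by rewrite tN tS; apply: vector_flip.
- rewrite soC // tN tS; have [z hz] := vector_flip l j d.
  by exists (- z); rewrite mulNmx hz scaleNr.
Qed.

(** Bilinear and not hermitian: u_d then pairs with the opposite vector. *)
Definition dot v w : C := (v^T *m w) 0 0.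

Lemma dotZl z v w : dot (z *: v) w = z * dot v w.
Proof. by rewrite /dot linearZ /= -scalemxAl mxE. Qed.

Lemma dotZr z v w : dot v (z *: w) = z * dot v w.
Proof. by rewrite /dot -scalemxAr mxE. Qed.

Lemma dot_sumr (I : finType) (f : I -> 'cV[C]_16) v :
  dot v (\sum_i f i) = \sum_i dot v (f i).
Proof. by rewrite /dot mulmx_sumr summxE. Qed.

Lemma dot_skew x y v w : dot (A x y *m v) w = - dot v (A x y *m w).
Proof. by rewrite /dot trmx_mul A_skew mulmxN mulNmx mxE mulmxA. Qed.

Lemma dot_opp d e : e != opp d -> dot (u d) (u e) = 0.
Proof.
move=> de; have /existsP [k dk] : [exists k, d k == e k].
  apply: contraNT de; rewrite negb_exists => /forallP H.
  by apply/eqP/ffunP => k; have := H k; rewrite !ffunE; case: (d k); case: (e k).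
have : dot (cartan A k *m u d) (u e) = - dot (u d) (cartan A k *m u e).
  by rewrite /cartan -!scalemxAl dotZl dotZr dot_skew mulrN.
rewrite !u_weight dotZl dotZr !mxE (eqP dk) => /eqP.
rewrite -addr_eq0 -mulr2n -mulr_natl !mulf_eq0 pnatr_eq0 /=.
by case: (e k); rewrite /= ?expr0 ?expr1 ?mulrN1z ?mulr1z ?oppr_eq0 oner_eq0 => /eqP.
Qed.

Lemma dot_nondegenerate v : (forall d, dot v (u d) = 0) -> v = 0.
Proof.
move=> hv; have H w : dot v w = 0.
  have [z ->] := spin_span w; rewrite dot_sumr big1 // => d _.
  by rewrite dotZr hv mulr0.
apply/colP => i; have := H (delta_mx i 0).
by rewrite /dot -colE !mxE.
Qed.

Lemma dot_opp_neq0 d : dot (u d) (u (opp d)) != 0.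
Proof.
apply: contraNneq (u_neq0 d) => d0; apply/eqP/dot_nondegenerate => e.
by have [->|/dot_opp] := eqVneq e (opp d).
Qed.

Lemma dot_so_neq0 x y d e : dot (u d) (A x y *m u e) != 0 ->
  forall m, (d m == e m) = touches x m (+) touches y m.
Proof.
have [z ->] := so_toggle x y e; rewrite dotZr => H; apply: toggle_opp.
by apply: contraNeq H => /dot_opp ->; rewrite mulr0.
Qed.

Definition so_span (G : 'M[C]_16) :=
  exists z : idx 4 -> idx 4 -> C, G = \sum_x \sum_y z x y *: A x y.

Lemma dot_so_span (z : idx 4 -> idx 4 -> C) v w :
  dot v ((\sum_x \sum_y z x y *: A x y) *m w)
  = \sum_x \sum_y z x y * dot v (A x y *m w).
Proof.
rewrite mulmx_suml dot_sumr; apply: eq_bigr => x _.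
rewrite mulmx_suml dot_sumr; apply: eq_bigr => y _.
by rewrite -scalemxAl dotZr.
Qed.

(** A generator pairs u_d with u_e only if d and e agree exactly in the Cartan
planes that contain exactly one of x and y. *)
Lemma agreement_le x y d e :
  dot (u d) (A x y *m u e) != 0 -> (agreement d e <= isSome x + isSome y)%N.
Proof.
move=> /dot_so_neq0 H; rewrite -!sum_touches -big_split /=; apply: leq_sum => m _.
by rewrite H; case: (touches x m); case: (touches y m).
Qed.

Lemma dot_agreement_gt2 G d e : so_span G -> (2 < agreement d e)%N ->
  dot (u d) (G *m u e) = 0.
Proof.
move=> [z ->] de; rewrite dot_so_span big1 // => x _; rewrite big1 // => y _.
suff -> : dot (u d) (A x y *m u e) = 0 by rewrite mulr0.
apply: contraTeq de => /agreement_le le2; rewrite -leqNgt (leq_trans le2) //.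
by case: x {le2} => [?|]; case: y.
Qed.

Lemma flipK k d : flip k (flip k d) = d.
Proof. by apply/ffunP => m; rewrite !ffunE addbK. Qed.

Lemma flip_agree k d e m : (flip k d m == flip k e m) = (d m == e m).
Proof. by rewrite !ffunE; case: (d m); case: (e m); case: (m == k). Qed.

(** The generators that pair u_d with u_e lie in the two planes where d and e
agree, hence commute with D = A_(k,0),None for a place k outside, and D
flips k in both vectors.  The factor between the two values does not depend on
the generator, so the relation passes to linear combinations. *)
Lemma dot_flip G k d e : so_span G -> agreement d e = 2%N -> d k != e k ->
  dot (u (flip k d)) (G *m u (flip k e)) = 0 -> dot (u d) (G *m u e) = 0.
Proof.
move=> [z ->] de2 dek; pose D := A (Some (k, false)) None.
have [z1 h1] := vector_flip k false d; have [z2 h2] := vector_flip k false e.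
have [z3 h3] := vector_flip k false (flip k e); rewrite flipK in h3.
have nz a t b : A (Some (k, false)) None *m u a = t *: u b -> t != 0.
  by move=> h; apply: contraNneq (vector_flip_neq0 k a) => t0; rewrite h t0 scale0r.
have z10 := nz _ _ _ h1; have z20 := nz _ _ _ h2; have z30 := nz _ _ _ h3.
have main x y : dot (u d) (A x y *m u e) =
    - (z1 / z3) * dot (u (flip k d)) (A x y *m u (flip k e)).
  have [H|H] := boolP [forall m, (d m == e m) == touches x m (+) touches y m]; last first.
    rewrite [LHS](_ : _ = 0); last first.
      apply: contraNeq H => /dot_so_neq0 H; apply/forallP => m.
      by rewrite H.
    rewrite [dot (u (flip _ _)) _](_ : _ = 0) ?mulr0 //.
    apply: contraNeq H => /dot_so_neq0 H; apply/forallP => m.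
    by rewrite -(flip_agree k) H.
  have {}H m : (d m == e m) = touches x m (+) touches y m.
    by move/forallP: H => /(_ m)/eqP.
  have le2 : (2 <= isSome x + isSome y)%N.
    rewrite -!sum_touches -big_split -{1}de2 /=; apply: leq_sum => m _.
    by rewrite H; case: (touches x m); case: (touches y m).
  have com w : D *m (A x y *m w) = A x y *m (D *m w).
    rewrite mxlie_apply [mxlie _ _](_ : _ = 0) ?mul0mx ?add0r //.
    case: x y le2 H => [[i s]|] [[j t]|] //= _ H.
    have := H k; rewrite (negPf dek); have [ki|ki] := eqVneq k i; last first.
      have [//|kj _] := eqVneq k j.
      by apply: so_lie_disjoint => //; apply/eqP => -[/eqP]; rewrite ?(negPf ki) ?(negPf kj).
    have [kj _|//] := eqVneq k j.
    have : agreement d e = 0%N.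
      by rewrite /agreement big1 // => m _; rewrite H -ki -kj; case: (m == k).
    by rewrite de2.
  have : dot (D *m u d) (A x y *m (D *m u e)) = - dot (u d) (A x y *m (D *m (D *m u e))).
    by rewrite dot_skew com.
  rewrite h1 h2 -!scalemxAr h3 -!scalemxAr dotZl !dotZr => h.
  apply: (mulfI z30); apply: (mulfI z20).
  by rewrite -[LHS]opprK -h; field.
rewrite !dot_so_span => h.
transitivity (- (z1 / z3) * \sum_x \sum_y z x y * dot (u (flip k d)) (A x y *m u (flip k e))).
  rewrite mulr_sumr; apply: eq_bigr => x _; rewrite mulr_sumr; apply: eq_bigr => y _.
  by rewrite main mulrCA.
by rewrite h mulr0.
Qed.

Definition linear_on_opposites (G : 'M[C]_16) := exists f : 'I_4 -> C, forall d,
  dot (u d) (G *m u (opp d))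
  = dot (u d) (u (opp d)) * \sum_k f k * (signs d 0 k)%:~R.

(** Only the Cartan elements pair opposite vectors, and on those they act by a
sign of d. *)
Lemma dot_opp_so x y : linear_on_opposites (A x y).
Proof.
have cartanE k : linear_on_opposites (cartan A k).
  exists (fun m => - (m == k)%:R) => d; rewrite u_weight dotZr mulrC; congr (_ * _).
  rewrite (bigD1 k) //= big1 => [|m /negPf ->]; last by rewrite oppr0 mul0r.
  rewrite eqxx addr0 !mxE ffunE.
  by case: (d k); rewrite /= ?expr0 ?expr1 ?mulrN1z ?mulr1z ?mulN1r ?opprK.
have scaled z G : linear_on_opposites G -> linear_on_opposites (z *: G).
  move=> [f hf]; exists (fun k => z * f k) => d.
  rewrite -scalemxAl dotZr hf mulrCA; congr (_ * _); rewrite mulr_sumr.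
  by apply: eq_bigr => k _; rewrite mulrA.
have zero : (forall d, dot (u d) (A x y *m u (opp d)) = 0) ->
    linear_on_opposites (A x y).
  by move=> h; exists (fun=> 0) => d; rewrite h big1 ?mulr0 // => k _; exact: mul0r.
have [/forallP H|H] := boolP [forall m, touches x m == touches y m]; last first.
  apply: zero => d; apply: contraNeq H => /dot_so_neq0 H; apply/forallP => m.
  have := H m; rewrite ffunE; case: (d m) => /=;
  by case: (touches x m); case: (touches y m).
have [<-|xy] := eqVneq x y.
  rewrite so_diag ?pnatr_eq0 // -(scale0r (cartan A ord0)).
  exact/scaled/cartanE.
case: x y H xy {zero} => [[k i]|] [[l j]|] //= H.
- have := H k; rewrite eqxx eq_sym eqb_id => /eqP <-.
  have two : 2%:R * 'i != 0 :> C by rewrite mulf_neq0 ?pnatr_eq0 ?neq0Ci.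
  have e01 : A (Some (k, false)) (Some (k, true)) = (2%:R * 'i)^-1 *: cartan A k.
    by rewrite scalerA mulVf // scale1r.
  case: i; case: j; rewrite ?eqxx // => _.
    by rewrite soC // e01 -scaleNr; exact/scaled/cartanE.
  by rewrite e01; exact/scaled/cartanE.
- by have := H k; rewrite eqxx.
- by have := H l; rewrite eqxx.
Qed.

Lemma dot_opp_span G : so_span G -> linear_on_opposites G.
Proof.
move=> [z ->].
have /fin_all_exists [g hg] (xy : idx 4 * idx 4) := dot_opp_so xy.1 xy.2.
exists (fun k => \sum_x \sum_y z x y * g (x, y) k) => d.
rewrite dot_so_span.
transitivity (\sum_x \sum_y dot (u d) (u (opp d)) *
    \sum_k z x y * g (x, y) k * (signs d 0 k)%:~R).
  apply: eq_bigr => x _; apply: eq_bigr => y _.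
  rewrite (hg (x, y)) mulrCA; congr (_ * _); rewrite mulr_sumr.
  by apply: eq_bigr => k _; rewrite mulrA.
under eq_bigr do rewrite -mulr_sumr.
rewrite -mulr_sumr; congr (_ * _).
under eq_bigr do rewrite exchange_big.
rewrite exchange_big; apply: eq_bigr => k _.
rewrite mulr_suml; apply: eq_bigr => x _.
by rewrite mulr_suml.
Qed.

Section Alternating.
Variable G : sgn -> 'M[C]_16.
Hypothesis G_span : forall a, so_span (G a).
Let p a b c := dot (u b) (G a *m u c).
Hypothesis p12 : forall a b c, p a b c = - p b a c.
Hypothesis p23 : forall a b c, p a b c = - p a c b.

Let p_agree a b c : (2 < agreement a b)%N -> p a b c = 0.
Proof.
by move=> ab; rewrite p23 p12 opprK /p dot_agreement_gt2.
Qed.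

Let sum_eq1 k : (\sum_(m < 4) (m == k) = 1)%N.
Proof. by rewrite (bigD1 k) //= eqxx big1 // => m /negPf ->. Qed.

(** The linear function of the signs f vanishes at a and at each flip of a, since
these agree with a in at least three places; hence every f k is 0. *)
Let p_opp a b : p a b (opp b) = 0.
Proof.
have [f hf] := dot_opp_span (G_span a).
suff f0 k : f k = 0.
  by rewrite /p hf big1 ?mulr0 // => k _; rewrite f0 mul0r.
have vanish e : (2 < agreement a e)%N -> \sum_k f k * (signs e 0 k)%:~R = 0.
  move=> /(p_agree (opp e)) /eqP; rewrite /p hf mulf_eq0 (negPf (dot_opp_neq0 e)).
  by move/eqP.
have aa : (2 < agreement a a)%N.
  by rewrite /agreement (eq_bigr (fun=> 1%N)) ?sum_nat_const ?card_ord // => m _; rewrite eqxx.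
have af : (2 < agreement a (flip k a))%N.
  rewrite -(ltn_add2r (\sum_(m < 4) (m == k))) {1}sum_eq1.
  rewrite -big_split /= (eq_bigr (fun=> 1%N)) ?sum_nat_const ?card_ord // => m _.
  by rewrite ffunE; case: (m == k); case: (a m).
have := congr2 (fun s t => s - t) (vanish _ aa) (vanish _ af).
rewrite /= -sumrB (bigD1 k) //= big1 => [|m mk].
  rewrite addr0 !mxE !ffunE eqxx subr0 -mulrBr => /eqP.
  rewrite mulf_eq0 => /orP [/eqP //|].
  case: (a k); rewrite /= ?expr0 ?expr1 ?mulrN1z ?mulr1z ?opprK -?opprD ?oppr_eq0 -mulr2n;
  by rewrite pnatr_eq0.
by rewrite !mxE !ffunE (negPf mk) addbF subrr.
Qed.

(** Where b and c differ, flips replace b by a and c by the opposite of a, one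
place of the list s at a time; b' s and c' s are the result. *)
Let p_agree2 a b c : agreement b c = 2%N -> p a b c = 0.
Proof.
move=> bc2.
pose b' (s : seq 'I_4) : sgn := [ffun m => if (b m != c m) && (m \in s) then a m else b m].
pose c' (s : seq 'I_4) : sgn := [ffun m => if (b m != c m) && (m \in s) then ~~ a m else c m].
have eq_bc s m : (b' s m == c' s m) = (b m == c m).
  by rewrite !ffunE; case: ifP => // /andP [/negPf -> _]; case: (a m).
have bc2' s : agreement (b' s) (c' s) = 2%N.
  by apply: etrans bc2; apply: eq_bigr => m _; rewrite eq_bc.
have descend s : p a (b' s) (c' s) = 0 -> p a b c = 0.
  elim: s => [|k s IH].
    have -> : b' [::] = b by apply/ffunP => m; rewrite ffunE andbF.
    by have -> : c' [::] = c by apply/ffunP => m; rewrite ffunE andbF.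
  move=> h; apply: IH; have [E|E] := boolP ((b k != c k) && (k \notin s) && (a k != b k)).
    have [/andP [bk ks] ak] := andP E.
    apply: (dot_flip (k := k) (G_span a) (bc2' s)); first by rewrite eq_bc.
    have -> : flip k (b' s) = b' (k :: s).
      apply/ffunP => m; rewrite !ffunE inE.
      have [->|_] := eqVneq m k; last by rewrite addbF.
      by move: bk ak; rewrite (negPf ks) andbF; case: (b k); case: (c k); case: (a k).
    have -> // : flip k (c' s) = c' (k :: s).
    apply/ffunP => m; rewrite !ffunE inE.
    have [->|_] := eqVneq m k; last by rewrite addbF.
    by move: bk ak; rewrite (negPf ks) andbF; case: (b k); case: (c k); case: (a k).
  have -> : b' s = b' (k :: s).
    apply/ffunP => m; rewrite !ffunE inE; have [->|//] := eqVneq m k.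
    by move: E; case: (k \in s); case: (b k); case: (c k); case: (a k).
  have -> // : c' s = c' (k :: s).
  apply/ffunP => m; rewrite !ffunE inE; have [->|//] := eqVneq m k.
  by move: E; case: (k \in s); case: (b k); case: (c k); case: (a k).
apply: (descend (enum 'I_4)).
have b'E m : b' (enum 'I_4) m = if b m != c m then a m else b m.
  by rewrite ffunE mem_enum andbT.
have c'E m : c' (enum 'I_4) m = if b m != c m then ~~ a m else c m.
  by rewrite ffunE mem_enum andbT.
have [/existsP [k /andP [/eqP bk /eqP ak]]|no] :=
  boolP [exists k, (b k == c k) && (a k == b k)].
  apply: p_agree.
  have d2 : (\sum_(m < 4) (b m != c m) = 2)%N.
    apply: (@addnI (agreement b c)); rewrite {2}bc2 -big_split /=.
    rewrite (eq_bigr (fun=> 1%N)) ?sum_nat_const ?card_ord // => m _.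
    by case: (b m == c m).
  have : (\sum_(m < 4) (b m != c m) + \sum_(m < 4) (m == k)
          <= agreement a (b' (enum 'I_4)))%N.
    rewrite -big_split; apply: leq_sum => m _; rewrite b'E.
    have [->|_] := eqVneq m k; first by rewrite bk ak bk !eqxx.
    by case: (b m == c m) => //=; rewrite eqxx.
  by rewrite d2 sum_eq1.
have -> : c' (enum 'I_4) = opp a.
  apply/ffunP => m; rewrite c'E ffunE; case: eqP => //= bm.
  move: no; rewrite negb_exists => /forallP /(_ m); rewrite bm eqxx /=.
  by case: (a m); case: (c m).
by rewrite p12 p_opp oppr0.
Qed.

(** Each of the four places contributes at least 1 to the sum of the three
agreements of a, b and c, so one of them is at least 2. *)
Lemma alternating_vanish a b c : p a b c = 0.
Proof.
have p_ge2 d e f : (2 <= agreement e f)%N -> p d e f = 0.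
  rewrite leq_eqVlt => /orP [/eqP/esym|]; first exact: p_agree2.
  by move=> ef; rewrite p12 p23 opprK; apply: p_agree.
have : (4 <= agreement b c + agreement a c + agreement a b)%N.
  rewrite -!big_split /= -[X in (X <= _)%N](_ : \sum_(m < 4) 1 = 4)%N; last first.
    by rewrite sum_nat_const card_ord.
  by apply: leq_sum => m _; case: (a m); case: (b m); case: (c m).
have [/p_ge2 -> //|bc] := leqP 2 (agreement b c).
have [/(p_ge2 b) ac _|ac] := leqP 2 (agreement a c); first by rewrite p12 ac oppr0.
have [/(p_ge2 c) ab _|ab] := leqP 2 (agreement a b).
  by rewrite p23 p12 ab !oppr0.
lia.
Qed.

End Alternating.

(** M i is the contraction of an alternating tensor with the i-th basis vector;
[alternating_vanish] applies to the contractions with the vectors u_a. *)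
Lemma skew_tensor_vanish (M : 'I_16 -> 'M[C]_16) :
  (forall i, so_span (M i)) ->
  (forall i j (k : 'I_16), M i j k = - M j i k) ->
  (forall i j (k : 'I_16), M i j k = - M i k j) ->
  forall i, M i = 0.
Proof.
move=> hM m12 m23.
pose G v := \sum_i v i 0 *: M i.
have dotG v w z : dot w (G v *m z) = \sum_i \sum_j \sum_(k < 16) v i 0 * w j 0 * M i j k * z k 0.
  rewrite mulmx_suml dot_sumr; apply: eq_bigr => i _.
  rewrite -scalemxAl dotZr /dot mxE mulr_sumr; apply: eq_bigr => j _.
  rewrite !mxE !mulr_sumr; apply: eq_bigr => k _.
  by rewrite !mulrA.
have G_span v : so_span (G v).
  have /fin_all_exists [g hg] := hM.
  exists (fun x y => \sum_i v i 0 * g i x y).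
  under [RHS]eq_bigr do under eq_bigr do rewrite scaler_suml.
  under [RHS]eq_bigr do rewrite exchange_big /=.
  rewrite exchange_big; apply: eq_bigr => i _ /=; rewrite {1}hg scaler_sumr.
  apply: eq_bigr => x _; rewrite scaler_sumr; apply: eq_bigr => y _.
  by rewrite scalerA.
have G0 v : G v = 0.
  have [z ->] := spin_span v.
  have lin : G (\sum_d z d *: u d) = \sum_d z d *: G (u d).
    rewrite /G; under [RHS]eq_bigr do rewrite scaler_sumr.
    rewrite exchange_big; apply: eq_bigr => i _ /=.
    rewrite summxE scaler_suml; apply: eq_bigr => d _.
    by rewrite mxE scalerA.
  rewrite lin big1 // => a _; rewrite [G _](_ : _ = 0) ?scaler0 //.
  have col0 c : G (u a) *m u c = 0.
    apply: dot_nondegenerate => b.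
    have -> : dot (G (u a) *m u c) (u b) = dot (u b) (G (u a) *m u c).
      by rewrite /dot !mxE; apply: eq_bigr => j _; rewrite !mxE mulrC.
    apply: (alternating_vanish (G := fun a => G (u a))) => [e|e f g|e f g].
    - exact: G_span.
    - rewrite !dotG exchange_big -sumrN; apply: eq_bigr => j _; rewrite -sumrN.
      apply: eq_bigr => i _; rewrite -sumrN; apply: eq_bigr => k _.
      by rewrite m12; ring.
    - rewrite !dotG -sumrN; apply: eq_bigr => i _; rewrite exchange_big -sumrN.
      apply: eq_bigr => j _; rewrite -sumrN; apply: eq_bigr => k _.
      by rewrite m23; ring.
  apply/matrixP => i j; rewrite [RHS]mxE.
  have [y hy] := spin_span (delta_mx j 0 : 'cV_16).
  have : G (u a) *m (delta_mx j 0 : 'cV_16) = 0.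
    by rewrite hy mulmx_sumr big1 // => c _; rewrite -scalemxAr col0 scaler0.
  by move/colP/(_ i); rewrite -colE !mxE.
move=> i; rewrite -(G0 (delta_mx i 0)) /G (bigD1 i) //= big1 => [|j /negPf ji].
  by rewrite mxE !eqxx scale1r addr0.
by rewrite mxE ji scale0r.
Qed.

End SpinCase.

(** * Real vectors of weight zero and irreducibility *)

Lemma so_relations_map (F K : comNzRingType) (f : {rmorphism F -> K})
    (I : eqType) n (A : I -> I -> 'M[F]_n) :
  so_relations A -> so_relations (fun x y => map_mx f (A x y)).
Proof.
move=> [sk rel]; split=> [x y|x y z w]; first by rewrite sk raddfN.
rewrite /mxlie -!map_mxM -raddfB -[_ - _]/(mxlie _ _) rel !(raddfD, raddfN) /=.
by rewrite !map_mxZ !rmorph_nat.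
Qed.

Definition rotation (F : nzRingType) n (i j : 'I_n) : 'M[F]_n :=
  delta_mx i j - delta_mx j i.

Lemma rotation_relations (F : comNzRingType) n : so_relations (@rotation F n).
Proof.
split=> [i j|i j k l]; rewrite /rotation; first by rewrite opprB.
rewrite /mxlie !mulmxBl !mulmxBr !mul_delta_mx_cond.
rewrite !(eq_sym k) !(eq_sym l) -!scaler_nat.
by apply/matrixP => p q; rewrite !mxE; ring.
Qed.

Section FixedVector.
Variables (F : fieldType) (r n : nat) (A : idx r -> idx r -> 'M[F]_n).
Hypothesis hA : so_relations A.
Hypothesis A_irr : forall U : {vspace 'cV[F]_n},
  (forall x y v, v \in U -> A x y *m v \in U) -> U = 0%VS \/ U = fullv.
Hypothesis r_gt1 : (1 < r)%N.
Hypothesis n_gt : ((r * 2).+1 < n)%N.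
Hypothesis char2 : 2%:R != 0 :> F.
Local Notation D x := (A (Some x) None).
Implicit Types (x y z : 'I_r * bool) (v : 'cV[F]_n).

Lemma span_not_stable (X : seq 'cV[F]_n) v : v \in X -> v != 0 -> (size X < n)%N ->
  ~ (forall (x y : idx r) w, w \in X -> A x y *m w \in <<X>>%VS).
Proof.
move=> vX v0 sX st.
have [x y w wX|U0|UT] := A_irr (U := <<X>>%VS).
- rewrite (coord_span (X := in_tuple X) wX) mulmx_sumr memv_suml // => i _.
  by rewrite -scalemxAr memvZ // st // mem_nth.
- by move: v0; rewrite -memv0 -U0 memv_span.
- by have := dim_span X; rewrite UT dimvf /dim /= muln1 leqNgt sX.
Qed.

(** Let D_x = A_x,None and q = D_x D_x v.  The commutators with so(2r) show that
q does not depend on x and that D_x D_y v = 0 for distinct x and y, also within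
one Cartan plane.  The relation D_x q = - D_x v makes q + v invariant.  If
q + v is nonzero it spans an invariant line; otherwise v and the vectors D_x v
span an invariant subspace of dimension at most 2r + 1. *)
Lemma no_zero_weight_vector v : v != 0 ->
  (forall x y, A (Some x) (Some y) *m v = 0) ->
  (forall k b l c, k != l -> D (k, b) *m (D (l, c) *m v) = 0) -> False.
Proof.
move=> v0 v_so v_far.
have lieD x y : x != y -> mxlie (A (Some x) (Some y)) (D y) = D x.
  by move=> xy; rewrite so_lie_chain.
have lieD' x y : x != y -> mxlie (A (Some x) (Some y)) (D x) = - D y.
  by move=> xy; rewrite (soC hA (Some x)) mxlieNl lieD // eq_sym.
have lieDD x y : x != y -> mxlie (D x) (D y) = - A (Some x) (Some y).
  by move=> xy; rewrite (soC hA (Some y)) mxlieNr so_lie_chain.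
have lie0 x y z : x != z -> y != z -> mxlie (A (Some x) (Some y)) (D z) = 0.
  by move=> xz yz; rewrite so_lie_disjoint.
have other k : exists l : 'I_r, l != k.
  have r0 : (0 < r)%N by apply: ltnW.
  have [k0|k0] := eqVneq (k : nat) 0%N.
    by exists (Ordinal r_gt1); rewrite -val_eqE /= k0.
  by exists (Ordinal r0); rewrite -val_eqE /= eq_sym.
have D_diff x y : x != y -> D x *m (D y *m v) = 0.
  case: x y => [k b] [l c] xy; have [kl|] := eqVneq k l; last exact: v_far.
  subst l; have [l lk] := other k.
  have := mxlie_apply (A (Some (k, c)) (Some (l, false))) (D (k, b))
            (D (l, false) *m v).
  rewrite v_far 1?eq_sym // mulmx0 lie0 ?mul0mx ?add0r.
  - rewrite (mxlie_apply (A (Some _) (Some _)) (D (l, false)) v) v_so mulmx0 addr0 lieD //.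
    by apply: contraNneq lk => -[->].
  - by rewrite eq_sym.
  - by apply: contraNneq lk => -[->].
have D_sq x y : D x *m (D x *m v) = D y *m (D y *m v).
  have [->//|xy] := eqVneq x y.
  have := mxlie_apply (A (Some x) (Some y)) (D x) (D y *m v).
  rewrite (D_diff x y xy) mulmx0 lieD' // mulNmx
    (mxlie_apply (A (Some _) (Some _)) (D y) v) v_so mulmx0 addr0 lieD //.
  by move/eqP; rewrite eq_sym addrC subr_eq0 => /eqP.
have [k0 hk0] : exists k : 'I_r, True by exists (Ordinal r_gt1).
pose x0 := (k0, false); pose q := D x0 *m (D x0 *m v).
have Dq x : D x *m q = - (D x *m v).
  have [l lk] := other x.1.
  have xy : x != (l, false) by apply: contraNneq lk => ->.
  rewrite /q (D_sq x0 (l, false)) mxlie_apply lieDD // D_diff // mulmx0 addr0.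
  by rewrite mulNmx mxlie_apply v_so mulmx0 addr0 lieD.
have q_so x y : A (Some x) (Some y) *m q = 0.
  have [<-|xy] := eqVneq x y.
    by rewrite so_diag // mul0mx.
  rewrite /q (D_sq x0 x) mxlie_apply lieD' // mulNmx D_diff 1?eq_sym // oppr0 add0r.
  by rewrite (mxlie_apply (A (Some _) (Some _)) (D x) v) v_so mulmx0 addr0
    lieD' // mulNmx mulmxN D_diff ?oppr0.
have ANN : A None None = 0 by apply: so_diag.
have [qv|qv] := eqVneq (q + v) 0; last first.
  apply: (span_not_stable (X := [:: q + v]) (v := q + v)); rewrite ?mem_head //.
    by apply: leq_ltn_trans n_gt.
  move=> x y w; rewrite inE => /eqP ->.
  suff -> : A x y *m (q + v) = 0 by apply: mem0v.
  have Dqv z : D z *m (q + v) = 0 by rewrite mulmxDr Dq addNr.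
  case: x y => [x|] [y|]; last by rewrite ANN mul0mx.
  - by rewrite mulmxDr q_so v_so addr0.
  - exact: Dqv.
  - by rewrite soC // mulNmx Dqv oppr0.
have {}qv : q = - v by apply/eqP; rewrite -addr_eq0 qv.
pose X := v :: map (fun x => D x *m v) (enum {: 'I_r * bool}).
have DX x : D x *m v \in <<X>>%VS.
  by apply: memv_span; rewrite inE (map_f (fun x => D x *m v)) ?orbT // mem_enum.
have vX : v \in <<X>>%VS by apply: memv_span; rewrite mem_head.
have DDX x y : D x *m (D y *m v) \in <<X>>%VS.
  have [->|xy] := eqVneq x y; last by rewrite D_diff // mem0v.
  by rewrite (D_sq y x0) -/q qv memvN.
apply: (span_not_stable (X := X) (v := v)); rewrite ?mem_head //.
  by rewrite /= size_map -cardE card_prod card_ord card_bool.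
move=> x y w; rewrite inE => /orP [/eqP ->|/mapP [z _ ->]].
  case: x y => [x|] [y|]; last by rewrite ANN mul0mx mem0v.
  - by rewrite v_so mem0v.
  - exact: DX.
  - by rewrite soC // mulNmx memvN.
case: x y => [x|] [y|]; last by rewrite ANN mul0mx mem0v.
- rewrite mxlie_apply v_so mulmx0 addr0.
  have [<-|xy] := eqVneq x y.
    by rewrite so_diag // /mxlie mul0mx mulmx0 subrr mul0mx mem0v.
  have [<-|yz] := eqVneq y z; last first.
    have [<-|xz] := eqVneq x z; first by rewrite lieD' // mulNmx memvN.
    by rewrite lie0 // mul0mx mem0v.
  by rewrite lieD.
- exact: DDX.
- by rewrite soC // mulNmx memvN.
Qed.

End FixedVector.

Section RealPoint.
Variable R : realType.
Local Notation cpx := (map_mx (real_complex R)).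

Lemma complex_map_apply (f : R[i] -> R) n (B : 'M[R]_n) (v : 'cV[R[i]]_n) :
  {morph f : s t / s + t} -> f 0 = 0 -> (forall a z, f (a%:C * z) = a * f z)%C ->
  map_mx f (cpx B *m v) = B *m map_mx f v.
Proof.
move=> fD f0 fZ; apply/matrixP => i j; rewrite !mxE.
rewrite (big_morph f fD f0); apply: eq_bigr => k _.
by rewrite !mxE fZ.
Qed.

(** f is the real part or the imaginary part, one of which is nonzero at v. *)
Lemma real_part_exists n (v : 'cV[R[i]]_n) : v != 0 ->
  exists w : 'cV[R]_n, w != 0 /\
    exists f : 'cV[R[i]]_n -> 'cV[R]_n, [/\ f v = w, f 0 = 0 &
      forall (B : 'M[R]_n) z, f (cpx B *m z) = B *m f z].
Proof.
move=> v0.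
have ReZ (a : R) (z : R[i]) : complex.Re (a%:C * z)%C = a * complex.Re z.
  by case: z => s t; rewrite /= mul0r subr0.
have ImZ (a : R) (z : R[i]) : complex.Im (a%:C * z)%C = a * complex.Im z.
  by case: z => s t; rewrite /= mul0r addr0.
have ReD : {morph (@complex.Re R) : s t / s + t} by case=> ? ? [].
have ImD : {morph (@complex.Im R) : s t / s + t} by case=> ? ? [].
have [re0|re0] := eqVneq (map_mx (@complex.Re R) v) 0.
  exists (map_mx (@complex.Im R) v); split; last first.
    exists (map_mx (@complex.Im R)); split=> //.
      by apply/matrixP => i j; rewrite !mxE.
    by move=> B z; apply: complex_map_apply.
  apply: contraNneq v0 => im0; apply/eqP/matrixP => i j; rewrite mxE.
  have := congr1 (fun M : 'cV_n => M i j) re0.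
  have := congr1 (fun M : 'cV_n => M i j) im0.
  by rewrite !mxE; case: (v i j) => s t /= -> ->.
exists (map_mx (@complex.Re R) v); split=> //.
exists (map_mx (@complex.Re R)); split=> //.
  by apply/matrixP => i j; rewrite !mxE.
by move=> B z; apply: complex_map_apply.
Qed.

End RealPoint.

Definition coordinate_index (x : idx 4) : 'I_9 :=
  cast_ord (etrans (card_option _) (congr1 succn (etrans (card_prod _ _)
    (congr2 muln (card_ord 4) card_bool)))) (enum_rank x).

Lemma coordinate_index_inj : injective coordinate_index.
Proof. by move=> x y /cast_ord_inj /enum_rank_inj. Qed.

Lemma coordinate_index_bij : bijective coordinate_index.
Proof.
apply: inj_card_bij coordinate_index_inj _.
by rewrite card_option card_prod !card_ord card_bool.
Qed.

(** * The image of the representation *)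

Section Representation.
Variables (R : realType) (rho : 'Hom(subvs_of (spin R 9), 'M[R]_16)).
Hypothesis rho_lie : lie_representation rho.

Definition rep_matrix (x y : idx 4) : 'M[R]_16 :=
  rho (vsproj (spin R 9) (rotation R (coordinate_index x) (coordinate_index y))).

Lemma rotation_spin i j : rotation R i j \in spin R 9.
Proof. by rewrite mem_so /rotation linearB /= !trmx_delta opprB. Qed.

Lemma rep_matrix_relations : so_relations rep_matrix.
Proof.
have [sk rel] := rotation_relations R 9.
split=> [x y|x y z w]; first by rewrite /rep_matrix sk !linearN.
rewrite -[mxlie _ _]/(lie_bracket (rep_matrix x y) (rep_matrix z w)) -rho_lie.
rewrite /spin_bracket !vsprojK ?rotation_spin //.
rewrite -[lie_bracket _ _]/(mxlie (rotation R _ _) (rotation R _ _)) rel.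
have lin a b c d (B1 B2 B3 B4 : 'M[R]_9) :
    rho (vsproj (spin R 9) (a *: B1 - b *: B2 - c *: B3 + d *: B4))
    = a *: rho (vsproj (spin R 9) B1) - b *: rho (vsproj (spin R 9) B2)
      - c *: rho (vsproj (spin R 9) B3) + d *: rho (vsproj (spin R 9) B4).
  by rewrite !linearD !linearN !linearZ.
by rewrite lin !(inj_eq coordinate_index_inj).
Qed.

Lemma limg_span (B : 'M[R]_16) : B \in limg rho ->
  exists z : idx 4 -> idx 4 -> R, B = \sum_x \sum_y z x y *: rep_matrix x y.
Proof.
case/memv_imgP => a _ ->; pose M := vsval a.
exists (fun x y => 2%:R^-1 * M (coordinate_index x) (coordinate_index y)).
have aE : a = \sum_x \sum_y (2%:R^-1 * M (coordinate_index x) (coordinate_index y))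
    *: vsproj (spin R 9) (rotation R (coordinate_index x) (coordinate_index y)).
  apply: val_inj => /=; rewrite -/M linear_sum /=.
  have two : 2%:R != 0 :> R by rewrite pnatr_eq0.
  have Mskew : M^T = - M by apply/eqP; rewrite -mem_so subvsP.
  transitivity (\sum_i \sum_j (2%:R^-1 * M i j) *: rotation R i j).
    rewrite /rotation; under eq_bigr do under eq_bigr do rewrite scalerBr.
    under eq_bigr do rewrite sumrB.
    rewrite sumrB [X in _ = _ - X]exchange_big /=.
    rewrite {1}[M]matrix_sum_delta -sumrB; apply: eq_bigr => i _.
    rewrite -sumrB; apply: eq_bigr => j _; rewrite -scalerBl; congr (_ *: _).
    have := congr1 (fun B : 'M_9 => B i j) Mskew; rewrite !mxE => ->.
    by field.
  rewrite (reindex _ (onW_bij _ coordinate_index_bij)) /=; apply: eq_bigr => x _.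
  rewrite (reindex _ (onW_bij _ coordinate_index_bij)) /= linear_sum.
  by apply: eq_bigr => y _; rewrite linearZ /= vsprojK // rotation_spin.
rewrite {1}aE linear_sum; apply: eq_bigr => x _; rewrite linear_sum.
by apply: eq_bigr => y _; rewrite linearZ.
Qed.

Lemma rep_matrix_limg x y : rep_matrix x y \in limg rho.
Proof. exact: memv_img (memvf _). Qed.

End Representation.

(** * Alternating forms *)

Section AlternatingForms.
Variables (R : realType) (n : nat) (T : form3 R n).
Hypothesis T_alt : Lambda3 T.
Local Notation e i := (delta_mx i 0 : 'cV[R]_n).

Lemma form3_swap12 X Y Z : T X Y Z = - T Y X Z.
Proof.
have [l1 l2 _ a1 _] := T_alt.
have := a1 (X + Y) Z.
have := l1 (X + Y) Z 1 X Y; have := l2 X Z 1 X Y; have := l2 Y Z 1 X Y.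
rewrite /= !scale1r !mul1r => -> -> ->.
by rewrite !a1 add0r addr0 => /eqP; rewrite addr_eq0 => /eqP.
Qed.

Lemma form3_swap23 X Y Z : T X Y Z = - T X Z Y.
Proof.
have [_ l2 l3 _ a2] := T_alt.
have := a2 X (Y + Z).
have := l2 X (Y + Z) 1 Y Z; have := l3 X Y 1 Y Z; have := l3 X Z 1 Y Z.
rewrite /= !scale1r !mul1r => -> -> ->.
by rewrite !a2 add0r addr0 => /eqP; rewrite addr_eq0 => /eqP.
Qed.

Lemma scalar_basis (f : 'cV[R]_n -> R) : scalar f ->
  (forall i, f (e i) = 0) -> forall X, f X = 0.
Proof.
move=> fl f0 X.
have z : f 0 = 0 by have := fl (-1) 0 0; rewrite scaler0 addr0 /= mulN1r addNr.
have -> : X = \sum_i X i 0 *: e i.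
  by rewrite {1}[X]matrix_sum_delta; apply: eq_bigr => i _; rewrite big_ord1.
by elim/big_rec: _ => // i Y _ Y0; rewrite fl Y0 f0 mulr0 addr0.
Qed.

Lemma form3_basis :
  (forall i j k, T (e i) (e j) (e k) = 0) -> forall X Y Z, T X Y Z = 0.
Proof.
move=> T0 X Y Z; have [l1 l2 l3 _ _] := T_alt.
apply: (scalar_basis (l1 Y Z)) => i; apply: (scalar_basis (l2 _ Z)) => j.
exact: (scalar_basis (l3 _ _)).
Qed.

End AlternatingForms.

Theorem propositionA1 (R : realType)
    (rho : 'Hom(subvs_of (spin R 9), 'M[R]_16)) :
  lie_representation rho ->
  (limg rho <= so R 16)%VS ->
  irreducible (limg rho) ->
  antisym_prolongation (limg rho) = [set (fun _ _ _ => 0) : form3 R 16].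
Proof.
move=> rho_lie rho_so [_ rho_irr]; apply/seteqP; split=> [T [T_alt T_g]|_ ->] /=; last first.
  split; first by split=> *; rewrite //= => ? ? ?; rewrite mulr0 addr0.
  move=> X; rewrite [form2_mx _](_ : _ = 0) ?mem0v //.
  by apply/matrixP => i j; rewrite !mxE.
have hA := rep_matrix_relations rho_lie.
pose AC x y := map_mx (real_complex R) (rep_matrix rho x y).
have hAC : so_relations AC := so_relations_map _ hA.
have AC_skew x y : (AC x y)^T = - AC x y.
  have : rep_matrix rho x y \in so R 16 by apply: (subvP rho_so); apply: rep_matrix_limg.
  rewrite mem_so => /eqP /matrixP sk; apply/matrixP => i j.
  by have := sk i j; rewrite !mxE => ->; rewrite rmorphN.
have A_irr (U : {vspace 'cV[R]_16}) :
    (forall x y v, v \in U -> rep_matrix rho x y *m v \in U) -> U = 0%VS \/ U = fullv.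
  move=> st; apply: rho_irr => B v /(limg_span (rho := rho)) [z ->] vU.
  rewrite mulmx_suml memv_suml // => x _; rewrite mulmx_suml memv_suml // => y _.
  by rewrite -scalemxAl memvZ // st.
have [spin_weights|[zero no_two]] := weights_dichotomy hAC; last first.
  have [v [v0 v_so v_far]] := zero_weight_vector hAC zero no_two.
  have [w [w0 [f [fv f0 fB]]]] := real_part_exists v0.
  exfalso; apply: (no_zero_weight_vector hA A_irr _ _ _ w0) => //.
  - by rewrite pnatr_eq0.
  - by move=> x y; rewrite -fv -fB v_so f0.
  - by move=> k b l c kl; rewrite -fv -!fB v_far // f0.
have /fin_all_exists2 [u u0 uw] := spin_weights.
pose M i := form2_mx (interior (delta_mx i 0) T).
have M_span i : so_span AC (map_mx (real_complex R) (M i)).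
  have [z zE] := limg_span (T_g (delta_mx i 0)).
  exists (fun x y => real_complex R (z x y)); rewrite /M zE.
  rewrite raddf_sum; apply: eq_bigr => x _; rewrite raddf_sum; apply: eq_bigr => y _.
  apply/matrixP => p q; rewrite !mxE; exact: (rmorphM (real_complex R)).
have M0 := skew_tensor_vanish hAC AC_skew u0 uw M_span.
apply/funext => X; apply/funext => Y; apply/funext => Z.
apply: (form3_basis T_alt) => i j k.
have /(_ _ _ i)/(congr1 (fun B : 'M_16 => B j k)) := M0.
rewrite !mxE => h; apply: (fmorph_inj (real_complex R)); rewrite rmorph0; apply: h.
  by move=> {}i {}j {}k; rewrite !mxE /interior form3_swap12 // rmorphN.
by move=> {}i {}j {}k; rewrite !mxE /interior form3_swap23 // rmorphN.
Qed.
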